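(* For any $\lambda>0$ there exist $\delta_0>0$ and $n_0$ such that, for any $\delta<\delta_0$ and $n\ge n_0$, a (suitably parametrized) version of the \textsc{Approximate Best Arm} algorithm $(\epsilon,\delta)$-learns a best arm among any $n$ arms, with sample complexity at most $\big(2+\lambda\big)\frac{n}{\epsilon^2}\log\frac{1}{\delta}$.
   Context: Setting: a set of $n$ arms; each arm $a$ has an unknown distribution supported on $[0,1]$ with mean $\mu(a)$; sampling returns an independent draw. $a^\star\in\arg\max_a\mu(a)$; an $\epsilon$-best arm is an arm $a$ with $\mu(a)\ge\mu(a^\star)-\epsilon$. An algorithm $(\epsilon,\delta)$-learns a best arm if on every such instance it outputs an $\epsilon$-best arm with probability at least $1-\delta$; its sample complexity is the worst-case total number of samples taken (integer rounding ignored). $\log$ is natural. The \textsc{Approximate Best Arm} algorithm with parameter $\alpha\in(0,1)$: choose a uniformly random set $R$ of $\frac{n^{7/8}}{2}$ arms; run an elimination procedure that repeatedly samples all surviving arms (in round $i=0,1,\ldots$ each arm $(i+1)\lceil\frac{2}{(\alpha\epsilon)^2}\log\frac{1}{\delta'}\rceil$ times, $\delta'$ a confidence parameter) and keeps only a $(\delta'+\phi)$-fraction of arms with largest empirical means until about $\frac{n^{3/4}}{2}$ arms $A_T$ remain (here $\phi$ is a vanishing function of $n$); then sample each arm of $A_T\cup R$ $\frac{2}{((1-\alpha)\epsilon)^2}\log\frac{|A_T\cup R|}{\delta''}$ times and output the one with largest empirical mean. The parameters $\alpha,\delta',\delta'',\phi$ may be chosen depending on $n$, $\delta$ and $\lambda$.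 *)

(* Defs.v *)
From HB Require Import structures.
From mathcomp Require Import all_boot all_order all_algebra.
From mathcomp Require Import all_classical all_reals all_analysis.
Set Implicit Arguments. Unset Strict Implicit. Unset Printing Implicit Defensive.
Import Order.TTheory GRing.Theory Num.Theory.
Import numFieldNormedType.Exports.
Local Open Scope classical_set_scope.
Local Open Scope ring_scope.

Section Bandit.
Variable R : realType.
Variable n : nat.

Definition arm_instance := 'I_n -> probability R R.

Definition supported01 (P : arm_instance) : Prop :=
  forall a : 'I_n, P a `[0%R, 1%R]%classic = 1%E.

Definition arm_mean (P : arm_instance) (a : 'I_n) : R :=
  fine (\int[P a]_x (x%:E))%E.

Definition eps_best (P : arm_instance) (eps : R) (a : 'I_n) : Prop :=
  forall b : 'I_n, arm_mean P b - eps <= arm_mean P a.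

(* Sample table: X a p j = j-th independent draw of arm a in phase p of the
   algorithm (fresh draws in every phase). *)
Definition table := 'I_n -> nat -> nat -> R.

Definition upd (X : table) (c : 'I_n * nat * nat) (x : R) : table :=
  fun a p j => if (a == c.1.1) && (p == c.1.2) && (j == c.2) then x else X a p j.

(* iterated integral: all coordinates listed in L are drawn independently,
   coordinate (a,p,j) with law P a *)
Fixpoint iint (P : arm_instance) (L : seq ('I_n * nat * nat))
  (f : table -> \bar R) (X : table) : \bar R :=
  match L with
  | [::] => f X
  | c :: L' => (\int[P c.1.1]_x iint P L' f (upd X c x))%E
  end.

Definition coords (M : nat) : seq ('I_n * nat * nat) :=
  flatten [seq [seq (ap, j) | ap <- [seq (a, p) | a <- enum 'I_n, p <- iota 0 M]]
           | j <- iota 0 M].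

Definition table0 : table := fun _ _ _ => 0.

Definition ceilN (x : R) : nat := `|Num.ceil x|%N.

Definition emp (X : table) (p m : nat) (a : 'I_n) : R :=
  (\sum_(j < m) X a p j) / m%:R.

(* arms of S sorted by decreasing value of f (ties broken by index) *)
Definition sorted_by (f : 'I_n -> R) (S : {set 'I_n}) : seq 'I_n :=
  sort (fun a b => f b <= f a) (enum S).

Definition top (k : nat) (f : 'I_n -> R) (S : {set 'I_n}) : {set 'I_n} :=
  [set a in take k (sorted_by f S)].

Record params := Params { alpha : R; dprime : R; dsecond : R; phi : R }.

Definition round_samples (pr : params) (eps : R) (i : nat) : nat :=
  i.+1 * ceilN (2 / (alpha pr * eps) ^+ 2 * ln (1 / dprime pr)).

Fixpoint elim (pr : params) (eps : R) (X : table) (fuel i : nat)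
  (S : {set 'I_n}) : {set 'I_n} * nat :=
  match fuel with
  | 0 => (S, 0%N)
  | fuel'.+1 =>
    if #|S|%:R <= ((n%:R : R) `^ (3 / 4 : R)) / 2 then (S, 0%N)
    else
      let m := round_samples pr eps i in
      let S' := top (ceilN ((dprime pr + phi pr) * #|S|%:R)) (emp X i m) S in
      let r := elim pr eps X fuel' i.+1 S' in
      (r.1, (#|S| * m + r.2)%N)
  end.

Definition rsize : nat := ceilN (((n%:R : R) `^ (7 / 8 : R)) / 2).

(* One run of Approximate Best Arm on random set Rs and sample table X:
   returns the output arm (None only if there is no arm) and the total number
   of samples taken. The final stage uses phase n.+2 of the table. *)
Definition aba (pr : params) (eps : R) (Rs : {set 'I_n}) (X : table)
  : option 'I_n * nat :=
  let e := elim pr eps X n.+1 0 [set: 'I_n] in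
  let B := e.1 :|: Rs in
  let N := ceilN (2 / ((1 - alpha pr) * eps) ^+ 2 * ln (#|B|%:R / dsecond pr)) in
  (ohead (sorted_by (emp X n.+2 N) B), (e.2 + #|B| * N)%N).

Definition success (P : arm_instance) (eps : R) (o : option 'I_n) : bool :=
  if o is Some a then `[< eps_best P eps a >] else false.

Definition success_prob (pr : params) (P : arm_instance) (eps : R) (M : nat)
  : \bar R :=
  ((#|[set Rs : {set 'I_n} | #|Rs| == rsize]|%:R)^-1%:E *
   \sum_(Rs : {set 'I_n} | #|Rs| == rsize)
     iint P (coords M)
       (fun X => if success P eps (aba pr eps Rs X).1 then 1 else 0)%E table0)%E.

End Bandit.

(* Main.v *)
(* Write [c = alpha * eps], call an arm good if its mean is within [c] of the
   best one, and let [L = ln (1 / delta)].  As soon as a good arm reaches the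
   final stage, a union bound over all arms and all possible sizes of the final
   set gives an eps-best output; the failure probability [dsecond] per arm is
   polynomially small in [n], which is cheap since only [O(n^(7/8))] arms are
   left.  A good arm reaches the final stage for one of three reasons.
   - If [delta <= exp (- n^(1/4))], then [ln (n / delta)] is [(1 + o(1)) L], so
     the first round can estimate all arms within [c / 2] at once and keep only
     the empirically best one, which is good.
   - Otherwise, if few arms are good, the best arm survives every round: by
     Hoeffding's inequality the number of bad arms whose empirical mean beats
     [mu(best) - c / 2] exceeds [(dprime + phi / 2) * #|S|] with probability at
     most [exp (- phi^2 * #|S| / 2)], and the few good arms fit in the remaining
     [phi / 2 * #|S|] places.
   - Otherwise the random set [R] contains a good arm, except with probability
     exponentially small in [n^(1/2)].
   The set of survivors shrinks geometrically with a small ratio, so the cost is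
   dominated by the first round, i.e. by [2 n L / (alpha eps)^2] with [alpha]
   close to 1. *)
Require Import Defs.
From HB Require Import structures.
From mathcomp Require Import all_boot all_order all_algebra.
From mathcomp Require Import all_classical all_reals all_analysis.
From mathcomp Require Import measurable_realfun ring lra zify.
Set Implicit Arguments. Unset Strict Implicit. Unset Printing Implicit Defensive.
Import Order.TTheory GRing.Theory Num.Theory.
Import numFieldNormedType.Exports.
Local Open Scope classical_set_scope.
Local Open Scope ring_scope.

(** * Hoeffding's lemma *)

Lemma ge0_of_derive_ge0 (R : realType) (f df : R -> R) (s : R) :
  (forall x : R, is_derive x 1 f (df x)) -> (forall x, 0 <= x -> 0 <= df x) ->
  f 0 = 0 -> 0 <= s -> 0 <= f s.
Proof.
move=> fdf df0 f0 s0.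
have cf : {within `[0, s], continuous f}.
  by apply: derivable_within_continuous => x _; have [] := fdf x.
have [c cs] := @MVT_segment R f df 0 s s0 (fun x _ => fdf x) cf.
rewrite f0 !subr0 => ->; apply: mulr_ge0 => //; apply: df0.
by move: cs; rewrite in_itv/= => /andP[].
Qed.

Section hoeffding_lemma.
Context {R : realType} (p : R).
Hypothesis p01 : 0 <= p <= 1.
(** The moment generating function of a Bernoulli variable of mean [p]. *)
Let D (s : R) := 1 - p + p * expR s.

Let D_gt0 s : 0 < D s.
Proof.
have /andP[p0 p1] := p01; have e0 := expR_gt0 s; rewrite /D.
have [->|pN0] := eqVneq p 0; first lra.
have : 0 < p by rewrite lt0r pN0.
by nra.
Qed.

Let DD s : is_derive s (1 : R) D (p * expR s).
Proof. by rewrite /D; apply: is_derive_eq; rewrite /GRing.scale/=; ring. Qed.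

(** The derivative of [s * p + s ^+ 2 / 8 - ln (D s)]. Both functions vanish at 0, so two rounds of
    [ge0_of_derive_ge0] reduce Hoeffding's lemma to the sign of the second derivative. *)
Let k (s : R) := p + s / 4 - 1 + (1 - p) * (D s)^-1.

Let k_ge0 s : 0 <= s -> 0 <= k s.
Proof.
pose dk x := 1/4 - (1-p) * ((p * expR x) / (D x) ^+ 2).
have dkE (x : R) : is_derive x 1 k (dk x).
  have Dx := DD x; have D0 := D_gt0 x.
  have H := is_deriveV (lt0r_neq0 D0) Dx.
  rewrite /k; apply: is_derive_eq; rewrite /dk /GRing.scale/=.
  by field; rewrite gt_eqF.
apply: (ge0_of_derive_ge0 dkE).
  move=> x x0; rewrite /dk subr_ge0 mulrA ler_pdivrMr ?exprn_gt0//.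
  (* The inequality [4 a b <= (a + b)^2] with [a = 1 - p] and [b = p * expR x], whose sum is
     [D x]. *)
  by have := sqr_ge0 (1 - p - p * expR x); rewrite /D; nra.
have D01 : D 0 = 1 by rewrite /D expR0 mulr1 subrK.
by rewrite /k D01 invr1 mul0r; ring.
Qed.

Lemma hoeffding_exp_ge0 s : 0 <= s -> 1 - p + p * expR s <= expR (s * p + s ^+ 2 / 8).
Proof.
move=> s0; rewrite -/(D s) -ler_ln ?posrE ?expR_gt0// expRK -subr_ge0.
have dg (x : R) : is_derive x 1 (fun s => s * p + s ^+ 2 / 8 - ln (D s)) (k x).
  have Dx := DD x; have D0 := D_gt0 x.
  have H := is_derive1_comp (is_derive1_ln D0) Dx.
  rewrite /comp in H.
  apply: is_derive_eq; rewrite /k /GRing.scale/=.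
  have -> : p * expR x = D x - (1 - p) by rewrite /D; ring.
  by field; rewrite gt_eqF.
apply: (ge0_of_derive_ge0 dg k_ge0 _ s0).
by rewrite /D expR0 mul0r expr0n/= mul0r mulr1 subrK ln1; ring.
Qed.

End hoeffding_lemma.

(** Exchanging the two outcomes of the Bernoulli variable turns [(p, s)] into [(1 - p, - s)], which
    reduces negative [s] to the previous case. *)
Lemma hoeffding_exp (R : realType) (p s : R) : 0 <= p <= 1 ->
  1 - p + p * expR s <= expR (s * p + s ^+ 2 / 8).
Proof.
move=> p01; have [s0|/ltW s0] := leP 0 s; first exact: hoeffding_exp_ge0.
have -> : 1 - p + p * expR s = expR s * (1 - (1 - p) + (1 - p) * expR (- s)).
  by rewrite expRN; field; rewrite gt_eqF ?expR_gt0.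
have -> : s * p + s ^+ 2 / 8 = s + (- s * (1 - p) + (- s) ^+ 2 / 8) by field.
rewrite expRD ler_pM2l ?expR_gt0//; apply: hoeffding_exp_ge0; last lra.
by apply/andP; split; lra.
Qed.

(** * Iterated integrals over sample tables *)

Section table_measurable.
Context {R : realType} {n : nat}.
Local Notation coord := ('I_n * nat * nat)%type.

Definition tget (c : coord) (X : table R n) : R := X c.1.1 c.1.2 c.2.

(** These generate the product sigma-algebra on tables, the smallest one that makes every single
    draw measurable. *)
Definition cylinders : set (set ('I_n -> nat -> nat -> R)) :=
  [set A | exists c, preimage_set_system setT (tget c) measurable A].

Definition mtable := g_sigma_algebraType cylinders.
HB.instance Definition _ := Measurable.on mtable.

Lemma measurable_tget c : measurable_fun [set: mtable] (tget c).
Proof.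
move=> _ A mA; rewrite setTI; apply: sub_sigma_algebra.
by exists c; exists A => //; rewrite setTI.
Qed.

Lemma measurable_mtable d (T : measurableType d) (f : T -> mtable) :
  (forall c, measurable_fun setT (tget c \o f)) -> measurable_fun setT f.
Proof.
move=> mf; apply: (@measurability _ _ T mtable setT f cylinders) => //.
move=> _ [_ [c [A mA <-]] <-]; rewrite !setTI.
by have := mf c measurableT A mA; rewrite setTI.
Qed.

Lemma tget_upd c (X : table R n) x c' : tget c' (upd X c x) = if c' == c then x else tget c' X.
Proof.
case: c c' => [[a p] j] [[a' p'] j']; rewrite /tget/upd/=.
by rewrite -[(a', p', j') == _]/((a' == a) && (p' == p) && (j' == j)).
Qed.

Lemma measurable_upd c :
  measurable_fun setT (fun z : mtable * R => upd z.1 c z.2 : mtable).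
Proof.
apply: measurable_mtable => c'.
rewrite (_ : _ \o _ = fun z => if c' == c then z.2 else tget c' z.1); last first.
  by apply/funext => z; rewrite /= tget_upd.
have [_|_] := eqVneq c' c; first exact: measurable_snd.
exact: (measurableT_comp (measurable_tget c') measurable_fst).
Qed.

Lemma measurable_upd2 c (X : mtable) : measurable_fun setT (fun x : R => upd X c x : mtable).
Proof.
apply: measurable_mtable => c'.
rewrite (_ : _ \o _ = fun x => if c' == c then x else tget c' X); last first.
  by apply/funext => x; rewrite /= tget_upd.
by have [_|_] := eqVneq c' c.
Qed.

End table_measurable.
Arguments mtable : clear implicits.

Lemma integral_prob_cst (R : realType) (Q : probability R R) (r : \bar R) :
  (\int[Q]_x r = r)%E.
Proof.
rewrite integral_cst//; transitivity (r * 1)%E; last exact: mule1.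
by congr (_ * _)%E; exact: probability_setT.
Qed.

Lemma emeasurable_prod d (T : measurableType d) (R : realType) (I : Type)
    (s : seq I) (F : I -> T -> \bar R) :
  (forall i, measurable_fun setT (F i)) ->
  measurable_fun setT (fun Y => \prod_(i <- s) F i Y)%E.
Proof.
move=> mF; elim: s => [|j s IH].
  by under eq_fun do rewrite big_nil; exact: measurable_cst.
by under eq_fun do rewrite big_cons; apply: emeasurable_funM.
Qed.

Section iint_theory.
Context {R : realType} {n : nat} (P : arm_instance R n).
Local Notation coord := ('I_n * nat * nat)%type.
Local Open Scope ereal_scope.
Implicit Types (f g : mtable R n -> \bar R) (L : seq coord).

Lemma iint_ge0 L f X : (forall X, 0 <= f X) -> 0 <= iint P L f X.
Proof.
move=> f0; elim: L X => //= c L IH X; exact: integral_ge0.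
Qed.

(** By Tonelli's theorem, integrating one coordinate of a nonnegative measurable function leaves a
    measurable function of the table. *)
Lemma measurable_iint L f : measurable_fun [set: mtable R n] f -> (forall X, 0 <= f X) ->
  measurable_fun [set: mtable R n] (iint P L f : mtable R n -> \bar R).
Proof.
move=> mf f0; elim: L => //= c L IH.
apply: (@measurable_fun_fubini_tonelli_F _ _ (mtable R n) R R (P c.1.1)
  (fun z => iint P L f (upd z.1 c z.2))).
- exact: (measurableT_comp IH (measurable_upd c)).
- by move=> z; exact: iint_ge0.
Qed.

Lemma measurable_iint_upd L f c X : measurable_fun [set: mtable R n] f -> (forall X, 0 <= f X) ->
  measurable_fun setT (fun x => iint P L f (upd X c x)).
Proof.
move=> mf f0.
exact: (measurableT_comp (measurable_iint L mf f0) (measurable_upd2 c X)).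
Qed.

Lemma iint_cst L (r : \bar R) X : 0 <= r -> iint P L (fun=> r) X = r.
Proof.
move=> r0; elim: L X => //= c L IH X.
under eq_integral do rewrite IH.
by rewrite integral_prob_cst.
Qed.

Lemma le_iint L f g X : measurable_fun [set: mtable R n] f -> measurable_fun [set: mtable R n] g ->
  (forall X, 0 <= f X) -> (forall X, f X <= g X) -> iint P L f X <= iint P L g X.
Proof.
move=> mf mg f0 fg; have g0 Y : 0 <= g Y := le_trans (f0 Y) (fg Y).
elim: L X => //= c L IH X; apply: ge0_le_integral => //.
- by move=> x _; exact: iint_ge0.
- exact: measurable_iint_upd.
- exact: measurable_iint_upd.
Qed.

Lemma iintD L f g X : measurable_fun [set: mtable R n] f -> measurable_fun [set: mtable R n] g ->
  (forall X, 0 <= f X) -> (forall X, 0 <= g X) ->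
  iint P L (fun Y => f Y + g Y) X = iint P L f X + iint P L g X.
Proof.
move=> mf mg f0 g0; elim: L X => //= c L IH X.
under eq_integral do rewrite IH.
apply: ge0_integralD => //.
- by move=> x _; exact: iint_ge0.
- exact: measurable_iint_upd.
- by move=> x _; exact: iint_ge0.
- exact: measurable_iint_upd.
Qed.

Lemma iintZl L f (r : \bar R) X : measurable_fun [set: mtable R n] f -> (forall X, 0 <= f X) ->
  0 <= r -> iint P L (fun Y => r * f Y) X = r * iint P L f X.
Proof.
move=> mf f0 r0; elim: L X => //= c L IH X.
under eq_integral do rewrite IH.
apply: ge0_integralZl => //.
- exact: measurable_iint_upd.
- by move=> x _; exact: iint_ge0.
Qed.

Lemma iint_sum (I : Type) (s : seq I) (F : I -> mtable R n -> \bar R) L X :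
  (forall i, measurable_fun [set: mtable R n] (F i)) -> (forall i X, 0 <= F i X) ->
  iint P L (fun Y => \sum_(i <- s) F i Y) X = \sum_(i <- s) iint P L (F i) X.
Proof.
move=> mF F0; elim: s => [|i s IH].
  rewrite big_nil -[RHS](@iint_cst L 0 X)//.
  by congr iint; apply/funext => Y; rewrite big_nil.
rewrite big_cons -IH -iintD//.
- by congr iint; apply/funext => Y; rewrite big_cons.
- exact: emeasurable_sum.
- by move=> Y; exact: sume_ge0.
Qed.

(* [f] reads the table only at the coordinates satisfying [A]. *)
Definition reads {T} (A : pred coord) (f : mtable R n -> T) :=
  forall X Y : table R n, (forall c, A c -> tget c X = tget c Y) -> f X = f Y.

Lemma reads_upd T (A : pred coord) (f : mtable R n -> T) c X x :
  reads A f -> ~~ A c -> f (upd X c x) = f X.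
Proof.
move=> rf Ac; apply: rf => c' Ac'; rewrite tget_upd.
by case: eqP => // cc'; move: Ac; rewrite -cc' Ac'.
Qed.

Lemma reads_iint (A : pred coord) f L : reads A f -> reads A (iint P L f).
Proof.
move=> rf; elim: L => //= c L IH X Y XY.
apply: eq_integral => x _; apply: IH => c' Ac'.
by rewrite !tget_upd; case: eqP => // _; exact: XY.
Qed.

(** Each coordinate is read by at most one factor, so at each integral the other factor is a
    constant and can be pulled out. *)
Lemma iint_indep (A B : pred coord) f g L X :
  measurable_fun [set: mtable R n] f -> measurable_fun [set: mtable R n] g ->
  (forall X, 0 <= f X) -> (forall X, 0 <= g X) ->
  reads A f -> reads B g -> (forall c, ~~ (A c && B c)) ->
  iint P L (fun Y => f Y * g Y) X = iint P L f X * iint P L g X.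
Proof.
move=> mf mg f0 g0 rf rg AB; elim: L X => //= c L IH X.
under eq_integral do rewrite IH.
have rfL := reads_iint L rf; have rgL := reads_iint L rg.
have [Ac|Ac] := boolP (A c).
  have Bc : ~~ B c by have := AB c; rewrite Ac.
  transitivity (\int[P c.1.1]_x (iint P L g X * iint P L f (upd X c x))).
    by apply: eq_integral => x _; rewrite (reads_upd _ _ rgL Bc) muleC.
  rewrite ge0_integralZl//.
  - rewrite muleC; congr (_ * _).
    under [RHS]eq_integral do rewrite (reads_upd _ _ rgL Bc).
    by rewrite integral_prob_cst.
  - exact: measurable_iint_upd.
  - by move=> x _; exact: iint_ge0.
  - exact: iint_ge0.
transitivity (\int[P c.1.1]_x (iint P L f X * iint P L g (upd X c x))).
  by apply: eq_integral => x _; rewrite (reads_upd _ _ rfL Ac).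
rewrite ge0_integralZl//.
- congr (_ * _).
  under [RHS]eq_integral do rewrite (reads_upd _ _ rfL Ac).
  by rewrite integral_prob_cst.
- exact: measurable_iint_upd.
- by move=> x _; exact: iint_ge0.
- exact: iint_ge0.
Qed.

(** Inner integrals overwrite outer ones, so the last occurrence of [c] in [L] sets the value; every
    other integral is that of a constant. *)
Lemma iint_tget (h : R -> \bar R) c L X : c \in L ->
  iint P L (h \o tget c) X = \int[P c.1.1]_x h x.
Proof.
have rh : reads (pred1 c) (h \o tget c).
  by move=> Y Z YZ; rewrite /= YZ//=.
elim: L X => //= c' L IH X; rewrite in_cons.
have [cL _|cL] := boolP (c \in L).
  under eq_integral do rewrite IH//.
  by rewrite integral_prob_cst.
rewrite orbF => /eqP <-.
apply: eq_integral => x _.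
suff -> Y : iint P L (h \o tget c) Y = h (tget c Y) by rewrite tget_upd eqxx.
elim: L cL Y {IH} => //= c1 L IH; rewrite in_cons negb_or => /andP[c1c cL] Y.
under eq_integral do rewrite IH// tget_upd (negbTE c1c).
by rewrite integral_prob_cst.
Qed.

Lemma iint_prod (I : eqType) (s : seq I) (A : I -> pred coord)
    (F : I -> mtable R n -> \bar R) L X :
  uniq s -> (forall i, measurable_fun [set: mtable R n] (F i)) -> (forall i X, 0 <= F i X) ->
  (forall i, reads (A i) (F i)) -> (forall i j c, A i c -> A j c -> i = j) ->
  iint P L (fun Y => \prod_(i <- s) F i Y) X = \prod_(i <- s) iint P L (F i) X.
Proof.
move=> us mF F0 rF dA; elim: s us => [_|i s IH /= /andP[iNs us]].
  rewrite big_nil -[RHS](@iint_cst L 1 X)//.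
  by congr iint; apply/funext => Y; rewrite big_nil.
rewrite big_cons -IH// -(iint_indep (A := A i) (B := [pred c | has (fun j => A j c) s]))//.
- by congr iint; apply/funext => Y; rewrite big_cons.
- exact: emeasurable_prod.
- by move=> Y; apply: prode_ge0.
- move=> Y Z YZ; rewrite big_seq [RHS]big_seq; apply: eq_bigr => j js.
  by apply: rF => c Ajc; apply: YZ; apply/hasP; exists j.
- move=> c; apply/negP => /andP[Aic] /hasP[j js Ajc].
  by move: iNs; rewrite (dA _ _ _ Aic Ajc) js.
Qed.

End iint_theory.

(** * Exponential moments and tail bounds *)

(** Convexity of the exponential between 0 and [s], with weight [x]. *)
Lemma le_expR_chord (R : realType) (s x : R) : 0 <= x <= 1 ->
  expR (s * x) <= 1 - x + x * expR s.
Proof.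
move=> /andP[x0 x1].
have t01 : Itv.spec (@Itv.num_sem R) (Itv.Real `[0%Z, 1%Z]) x.
  by apply/and3P; split => //; exact: num_real.
have := @convex_expR R (Itv.mk t01) s 0.
rewrite !convRE/= expR0 mulr0 addr0 mulr1 [x * s]mulrC => /le_trans; apply.
by rewrite addrC.
Qed.

Section mgf.
Context {R : realType} (Q : probability R R).
Hypothesis Q01 : Q `[0%R, 1%R]%classic = 1%E.
Let mu := fine (\int[Q]_x x%:E)%E.

Lemma ae01 : {ae Q, forall x, 0 <= x <= 1}.
Proof.
exists (~` `[0, 1]%classic); split.
- by apply: measurableC; exact: measurable_itv.
- rewrite -/(setC _) probability_setC; last exact: measurable_itv.
  by rewrite Q01 subee.
- by apply: subsetC => x /=; rewrite in_itv.
Qed.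

(** The law lives on the unit interval only almost surely, while integrals of nonnegative functions
    split under pointwise sign conditions. Clipping provides these without changing any integral,
    and it shows that the mean is finite. *)
Let clip (x : R) := Num.max 0 (Num.min x 1).

Let clip01 x : 0 <= clip x <= 1.
Proof. by rewrite /clip le_max lexx/= ge_max ler01 ge_min lexx orbT. Qed.

Let clipE x : 0 <= x <= 1 -> clip x = x.
Proof. by move=> /andP[x0 x1]; rewrite /clip min_l// max_r. Qed.

Let mclip : measurable_fun setT clip.
Proof. by apply: measurable_maxr => //; exact: measurable_minr. Qed.

Let integral_clip : (\int[Q]_x (clip x)%:E = \int[Q]_x x%:E)%E.
Proof.
apply: ae_eq_integral => //; try exact/measurable_EFinP.
by move: ae01; apply: filterS => x x01 _; rewrite clipE.
Qed.

Let clip_bounds : (0 <= \int[Q]_x (clip x)%:E <= 1)%E.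
Proof.
apply/andP; split.
  by apply: integral_ge0 => x _; rewrite lee_fin; case/andP: (clip01 x).
rewrite -[leRHS](integral_prob_cst Q 1); apply: ge0_le_integral => //.
- by move=> x _; rewrite lee_fin; case/andP: (clip01 x).
- exact/measurable_EFinP.
- by move=> x _; rewrite lee_fin; case/andP: (clip01 x).
Qed.

Let muE : (\int[Q]_x (clip x)%:E = mu%:E)%E.
Proof.
have /andP[h0 h1] := clip_bounds.
by rewrite /mu -integral_clip fineK// ge0_fin_numE// (le_lt_trans h1)// ltry.
Qed.

Lemma mean01 : 0 <= mu <= 1.
Proof. by rewrite -!lee_fin -muE clip_bounds. Qed.

Let integral_compl_clip : (\int[Q]_x (1 - clip x)%:E = (1 - mu)%:E)%E.
Proof.
have : (\int[Q]_x ((1 - clip x)%:E + (clip x)%:E) = 1)%E.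
  by rewrite -[RHS](integral_prob_cst Q 1); apply: eq_integral => x _; rewrite -EFinD subrK.
rewrite ge0_integralD//.
- by rewrite muE; case: (integral _ _ _) => //= r; rewrite -EFinD => -[<-]; rewrite addrK.
- by move=> x _; rewrite lee_fin subr_ge0; case/andP: (clip01 x).
- by apply/measurable_EFinP; exact: measurable_funB.
- by move=> x _; rewrite lee_fin; case/andP: (clip01 x).
- exact/measurable_EFinP.
Qed.

(** The chord bound replaces the law by a Bernoulli law of the same mean, to which Hoeffding's lemma
    applies. The shift [r] will carry the threshold of a tail event. *)
Lemma mgf_le (s r : R) :
  (\int[Q]_x (expR (s * x + r))%:E <= (expR (s * mu + s ^+ 2 / 8 + r))%:E)%E.
Proof.
apply: (@le_trans _ _ (\int[Q]_x
    ((expR r)%:E * ((1 - clip x)%:E + (expR s)%:E * (clip x)%:E)))%E).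
  apply: ae_ge0_le_integral => //.
  - apply/measurable_EFinP; apply: measurableT_comp; first exact: measurable_expR.
    by apply: measurable_funD => //; exact: measurable_funM.
  - move=> x _; have /andP[c0 c1] := clip01 x.
    change (0 <= (expR r * ((1 - clip x) + expR s * clip x))%:E)%E; rewrite lee_fin.
    by apply: mulr_ge0; rewrite ?expR_ge0// addr_ge0 ?subr_ge0// mulr_ge0 ?expR_ge0.
  - apply/measurable_EFinP; apply: measurable_funM => //.
    by apply: measurable_funD; [exact: measurable_funB|exact: measurable_funM].
  - move: ae01; apply: filterS => x x01 _; rewrite clipE//.
    change ((expR (s * x + r))%:E <= (expR r * ((1 - x) + expR s * x))%:E)%E.
    rewrite lee_fin expRD mulrC ler_pM2l ?expR_gt0//.
    by rewrite [expR s * x]mulrC; exact: le_expR_chord.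
have mc : measurable_fun setT (fun x => (clip x)%:E) by exact/measurable_EFinP.
have mc1 : measurable_fun setT (fun x => (1 - clip x)%:E).
  by apply/measurable_EFinP; exact: measurable_funB.
have c0 x : (0 <= (clip x)%:E)%E by rewrite lee_fin; case/andP: (clip01 x).
have c1 x : (0 <= (1 - clip x)%:E)%E by rewrite lee_fin subr_ge0; case/andP: (clip01 x).
have e0 x : (0 <= (expR x)%:E)%E by rewrite lee_fin expR_ge0.
have mec : measurable_fun setT (fun x => (expR s)%:E * (clip x)%:E)%E.
  exact: measurable_funeM.
rewrite ge0_integralZl//; last 2 first.
- exact: emeasurable_funD.
- by move=> x _; rewrite adde_ge0// mule_ge0.
rewrite ge0_integralD//; last by move=> x _; rewrite mule_ge0.
rewrite ge0_integralZl// muE integral_compl_clip.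
change ((expR r * ((1 - mu) + expR s * mu))%:E
  <= (expR (s * mu + s ^+ 2 / 8 + r))%:E)%E.
rewrite lee_fin [leRHS]expRD [leRHS]mulrC ler_pM2l ?expR_gt0// [expR s * mu]mulrC.
exact: hoeffding_exp mean01.
Qed.

End mgf.

Lemma prode_le_exprn (R : realType) (I : eqType) (s : seq I) (F : I -> \bar R) (c : R) :
  (forall i, i \in s -> 0 <= F i <= c%:E)%E -> 0 <= c ->
  (\prod_(i <- s) F i <= (c ^+ size s)%:E)%E.
Proof.
move=> F0c c0; elim: s F0c => [|i s IH] F0c; first by rewrite big_nil.
rewrite big_cons exprS EFinM; have /andP[Fi0 Fic] := F0c i (mem_head _ _).
apply: lee_pmul => //.
- rewrite big_seq; apply: prode_ge0 => j js.
  by have := F0c j; rewrite in_cons js orbT => /(_ isT)/andP[].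
- by apply: IH => j js; apply: F0c; rewrite in_cons js orbT.
Qed.

(** * Measurability of events determined by finitely many Boolean tests *)

Section measurable_bool.
Context {d : measure_display} {T : measurableType d}.

Lemma measurable_has (I : Type) (s : seq I) (B : I -> T -> bool) :
  (forall i, measurable_fun setT (B i)) ->
  measurable_fun setT (fun X => has (B^~ X) s).
Proof.
move=> mB; elim: s => [|i s IH] /=; first exact: measurable_cst.
exact: measurable_or.
Qed.

Lemma measurable_all (I : Type) (s : seq I) (B : I -> T -> bool) :
  (forall i, measurable_fun setT (B i)) ->
  measurable_fun setT (fun X => all (B^~ X) s).
Proof.
move=> mB; elim: s => [|i s IH] /=; first exact: measurable_cst.
exact: measurable_and.
Qed.

(** Meant for rankings: the order of the arms depends on the draws only through the finitely many
    comparisons between two empirical means. *)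
Lemma measurable_finite (I : finType) (U : eqType) (B : I -> T -> bool)
    (h : {ffun I -> bool} -> U) (t : U) :
  (forall i, measurable_fun setT (B i)) ->
  measurable_fun setT (fun X => h [ffun i => B i X] == t).
Proof.
move=> mB; rewrite (_ : (fun X => _) = fun X =>
  has (fun v : {ffun I -> bool} => (h v == t) && all (fun i => B i X == v i) (enum I))
    (enum {ffun I -> bool})); last first.
  apply/funext => X; apply/idP/hasP => [ht|[v _ /andP[/eqP <- /allP Bv]]].
    exists [ffun i => B i X]; first by rewrite mem_enum.
    by rewrite ht; apply/allP => i _; rewrite ffunE.
  by apply/eqP; congr h; apply/ffunP => i; rewrite ffunE; apply/eqP/Bv; rewrite mem_enum.
apply: (measurable_has _ (B := fun v X => (h v == t) && all (fun i => B i X == v i) (enum I))).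
move=> v; apply: measurable_and; first exact: measurable_cst.
apply: (measurable_all _ (B := fun i X => B i X == v i)) => i.
case: (v i).
  by rewrite (_ : (fun _ => _) = B i)//; apply/funext => X; rewrite eqb_id.
rewrite (_ : (fun _ => _) = fun X => ~~ B i X); first exact: measurable_neg.
by apply/funext => X; rewrite eqbF_neg.
Qed.

End measurable_bool.

Section prob_events.
Context {R : realType} {n : nat} (P : arm_instance R n) (L : seq ('I_n * nat * nat)).
Local Open Scope ereal_scope.
Implicit Types b : mtable R n -> bool.

Definition ind b (X : mtable R n) : \bar R := if b X then 1 else 0.

(** Coordinates outside [L] keep the value 0, which is why the tail bounds ask for the relevant
    draws to lie in [L]. *)
Definition Pr b : \bar R := iint P L (ind b) (@table0 R n).

Lemma ind_ge0 b X : 0 <= ind b X.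
Proof. by rewrite /ind; case: ifP. Qed.

Lemma measurable_ind b : measurable_fun [set: mtable R n] b ->
  measurable_fun [set: mtable R n] (ind b).
Proof. by move=> mb; apply: measurable_fun_ifT. Qed.

Lemma Pr_ge0 b : 0 <= Pr b.
Proof. by apply: iint_ge0 => X; exact: ind_ge0. Qed.

Lemma markov b (f : mtable R n -> \bar R) :
  measurable_fun [set: mtable R n] b -> measurable_fun [set: mtable R n] f ->
  (forall X, 0 <= f X) -> (forall X, b X -> 1 <= f X) ->
  Pr b <= iint P L f (@table0 R n).
Proof.
move=> mb mf f0 bf; apply: le_iint => //; first exact: measurable_ind.
  by move=> X; exact: ind_ge0.
by move=> X; rewrite /ind; case: ifPn => // /bf.
Qed.

Lemma le_Pr b1 b2 :
  measurable_fun [set: mtable R n] b1 -> measurable_fun [set: mtable R n] b2 ->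
  (forall X, b1 X -> b2 X) -> Pr b1 <= Pr b2.
Proof.
move=> m1 m2 b12; apply: markov => //; first exact: measurable_ind.
  by move=> X; exact: ind_ge0.
by move=> X /b12; rewrite /ind => ->.
Qed.

Lemma PrC b : measurable_fun [set: mtable R n] b -> Pr b + Pr (fun X => ~~ b X) = 1.
Proof.
move=> mb; rewrite /Pr -iintD; first last.
- by move=> X; exact: ind_ge0.
- by move=> X; exact: ind_ge0.
- by apply: measurable_ind; exact: measurable_neg.
- exact: measurable_ind.
rewrite -[RHS](iint_cst P L (@table0 R n) lee01); congr iint.
by apply/funext => X; rewrite /ind; case: (b X); rewrite /= ?adde0 ?add0e.
Qed.

Lemma Pr_has (I : Type) (s : seq I) (B : I -> mtable R n -> bool) :
  (forall i, measurable_fun [set: mtable R n] (B i)) ->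
  Pr (fun X => has (B^~ X) s) <= \sum_(i <- s) Pr (B i).
Proof.
move=> mB; rewrite /Pr -iint_sum; last 2 first.
- by move=> i; exact: measurable_ind.
- by move=> i X; exact: ind_ge0.
apply: markov; first exact: measurable_has.
- by apply: emeasurable_sum => i; exact: measurable_ind.
- by move=> X; apply: sume_ge0 => i _; exact: ind_ge0.
- move=> X; elim: s => //= i s IH; rewrite big_cons {1}/ind.
  case: (B i X) => /= [_|/IH h]; last by rewrite add0e.
  by rewrite leeDl// sume_ge0// => j _; exact: ind_ge0.
Qed.

(* Markov's inequality for the exponential, whose moments multiply over the [m]
   independent draws. *)
Lemma emp_mgf (s th : R) a p m : (0 < m)%N -> supported01 P ->
  (forall j, (j < m)%N -> (a, p, j) \in L) ->
  Pr (fun X => 0 <= s * (emp X p m a - th))%R <=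
  (expR (m%:R * (s * (arm_mean P a - th) + s ^+ 2 / 8)))%:E.
Proof.
move=> m0 P01 inL.
pose F (j : nat) (X : mtable R n) : \bar R := (expR (s * tget (a, p, j) X - s * th))%:E.
have mF j : measurable_fun [set: mtable R n] (F j).
  apply/measurable_EFinP; apply: measurableT_comp; first exact: measurable_expR.
  apply: measurable_funB => //; apply: measurable_funM => //.
  exact: measurable_tget.
have F0 j X : 0 <= F j X by rewrite lee_fin expR_ge0.
have memp : measurable_fun [set: mtable R n] (fun X => emp X p m a).
  apply: measurable_funM => //.
  apply: measurable_sum => j; exact: (measurable_tget (a, p, j : nat)).
have mb : measurable_fun [set: mtable R n] (fun X => 0 <= s * (emp X p m a - th))%R.
  apply: measurable_fun_ler => //; apply: measurable_funM => //.
  exact: measurable_funB.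
apply: (@le_trans _ _ (iint P L (fun X => \prod_(j <- index_iota 0 m) F j X) (@table0 R n))).
  apply: markov => //.
  - exact: emeasurable_prod.
  - by move=> X; apply: prode_ge0.
  - move=> X sX.
    have -> : \prod_(j <- index_iota 0 m) F j X = (expR (m%:R * (s * (emp X p m a - th))))%:E.
      rewrite prodEFin; congr EFin; rewrite -expR_sum; congr expR.
      rewrite big_mkord sumrB -mulr_sumr sumr_const card_ord -[(s * th *+ m)%R]mulr_natl.
      rewrite 2!mulrBr; congr (_ - _)%R; rewrite [RHS]mulrCA; congr (_ * _)%R.
      by rewrite /emp mulrCA divff ?mulr1// pnatr_eq0 -lt0n.
    rewrite lee_fin -[leLHS]expR0 ler_expR mulr_ge0// ltW// ltr0n//.
rewrite (@iint_prod R n P _ _ (fun j => pred1 (a, p, j))) ?iota_uniq//; last 2 first.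
- by move=> j Y Z YZ; rewrite /F YZ//=.
- by move=> i j c /eqP-> /eqP[].
rewrite expRM_natl; apply: le_trans (prode_le_exprn _ _) _.
- move=> j; rewrite mem_index_iota => /andP[_ jm]; apply/andP; split; first exact: iint_ge0.
  rewrite (_ : F j = (fun x => (expR (s * x - s * th))%:E) \o tget (a, p, j))//.
  rewrite iint_tget; last exact: inL.
  exact: (mgf_le (P01 a)).
- exact: expR_ge0.
- rewrite lee_fin size_iota subn0 lerXn2r ?nnegrE ?expR_ge0// ler_expR /arm_mean.
  by rewrite le_eqVlt; apply/orP; left; apply/eqP; ring.
Qed.

Lemma measurable_emp a p m : measurable_fun [set: mtable R n] (fun X => emp X p m a).
Proof.
apply: measurable_funM => //.
by apply: measurable_sum => j; exact: (measurable_tget (a, p, j : nat)).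
Qed.

(** The exponent [s = 4 * (th - mean)] minimises [s * (mean - th) + s ^+ 2 / 8], with minimum
    [- 2 * (th - mean) ^+ 2]. Its sign selects the tail, so the lower tail below uses the same
    formula. *)
Lemma emp_ge_tail (th : R) a p m : (0 < m)%N -> (arm_mean P a <= th)%R -> supported01 P ->
  (forall j, (j < m)%N -> (a, p, j) \in L) ->
  Pr (fun X => th <= emp X p m a)%R <=
  (expR (- (2 * m%:R * (th - arm_mean P a) ^+ 2)))%:E.
Proof.
move=> m0 t0 P01 inL.
have := @emp_mgf (4 * (th - arm_mean P a)) th a p m m0 P01 inL.
rewrite (_ : m%:R * _ = - (2 * m%:R * (th - arm_mean P a) ^+ 2))%R; last by field.
apply: le_trans; apply: le_Pr => [||X thX].
- by apply: measurable_fun_ler => //; exact: measurable_emp.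
- apply: measurable_fun_ler => //; apply: measurable_funM => //.
  by apply: measurable_funB => //; exact: measurable_emp.
- by rewrite mulr_ge0 ?subr_ge0// mulr_ge0 ?subr_ge0.
Qed.

Lemma emp_le_tail (th : R) a p m : (0 < m)%N -> (th <= arm_mean P a)%R -> supported01 P ->
  (forall j, (j < m)%N -> (a, p, j) \in L) ->
  Pr (fun X => emp X p m a <= th)%R <=
  (expR (- (2 * m%:R * (th - arm_mean P a) ^+ 2)))%:E.
Proof.
move=> m0 t0 P01 inL.
have := @emp_mgf (4 * (th - arm_mean P a)) th a p m m0 P01 inL.
rewrite (_ : m%:R * _ = - (2 * m%:R * (th - arm_mean P a) ^+ 2))%R; last by field.
apply: le_trans; apply: le_Pr => [||X thX].
- by apply: measurable_fun_ler => //; exact: measurable_emp.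
- apply: measurable_fun_ler => //; apply: measurable_funM => //.
  by apply: measurable_funB => //; exact: measurable_emp.
- by rewrite mulr_le0// ?subr_le0// mulr_ge0_le0 ?subr_le0.
Qed.

Lemma Pr_indep (A B : pred ('I_n * nat * nat)) b1 b2 :
  measurable_fun [set: mtable R n] b1 -> measurable_fun [set: mtable R n] b2 ->
  reads A b1 -> reads B b2 -> (forall c, ~~ (A c && B c)) ->
  Pr (fun X => b1 X && b2 X) = Pr b1 * Pr b2.
Proof.
move=> m1 m2 r1 r2 AB; rewrite /Pr -(@iint_indep R n P A B)//.
- congr iint; apply/funext => X; rewrite /ind.
  by case: (b1 X) => /=; rewrite ?mul1e ?mul0e.
- exact: measurable_ind.
- exact: measurable_ind.
- by move=> X; exact: ind_ge0.
- by move=> X; exact: ind_ge0.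
- by move=> X Y XY; rewrite /ind (r1 X Y XY).
- by move=> X Y XY; rewrite /ind (r2 X Y XY).
Qed.

Lemma countE (S : seq 'I_n) (b : 'I_n -> mtable R n -> bool) X :
  ((count (b^~ X) S)%:R = \sum_(a <- S) (b a X)%:R :> R)%R.
Proof.
rewrite -sum1_count natr_sum big_mkcond/=.
by apply: eq_bigr => a _; case: (b a X).
Qed.

Lemma measurable_count (S : seq 'I_n) (b : 'I_n -> mtable R n -> bool) :
  (forall a, measurable_fun [set: mtable R n] (b a)) ->
  measurable_fun [set: mtable R n] (fun X => (count (b^~ X) S)%:R : R).
Proof.
move=> mb; rewrite (_ : (fun X => _) = fun X => \sum_(a <- S) if b a X then 1 else 0)%R.
  by apply: measurable_sum => a; exact: measurable_fun_ifT.
by apply/funext => X; rewrite countE; apply: eq_bigr => a _; case: (b a X).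
Qed.

(** A Chernoff bound for indicators that are independent because they read disjoint sets of draws.
    The bound [N] may exceed the number of arms counted: it will be the size of the whole surviving
    set, while only its bad arms are counted. *)
Lemma count_tail (S : seq 'I_n) (b : 'I_n -> mtable R n -> bool)
    (A : 'I_n -> pred ('I_n * nat * nat)) (q phi N : R) :
  uniq S -> (forall a, measurable_fun [set: mtable R n] (b a)) ->
  (forall a, reads (A a) (b a)) -> (forall a a' c, A a c -> A a' c -> a = a') ->
  (forall a, a \in S -> Pr (b a) <= q%:E) -> (0 <= q <= 1)%R -> (0 <= phi)%R ->
  ((size S)%:R <= N)%R ->
  Pr (fun X => (q + phi / 2) * N <= (count (b^~ X) S)%:R)%R <=
  (expR (- (phi ^+ 2 * N / 2)))%:E.
Proof.
move=> uS mb rb dA bq /andP[q0 q1] phi0 SN.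
(* This minimises [s ^+ 2 / 8 - s * phi / 2], the exponent per unit of [N]. *)
pose s : R := (2 * phi)%R.
have s0 : (0 <= s)%R by rewrite mulr_ge0.
pose F a X : \bar R := (expR (s * (b a X)%:R))%:E.
(* The exponential of an indicator is affine in it, so its expectation needs only a bound on
   [Pr (b a)]. *)
have FE a : F a = fun X => 1 + (expR s - 1)%:E * ind (b a) X.
  apply/funext => X; rewrite /F /ind; case: (b a X).
    by rewrite mule1 mulr1 -EFinD addrC subrK.
  by rewrite mule0 mulr0 adde0 expR0.
have es1 : (0 <= expR s - 1)%R by rewrite subr_ge0 -[leLHS]expR0 ler_expR.
have mF a : measurable_fun [set: mtable R n] (F a).
  rewrite FE; apply: emeasurable_funD => //; apply: measurable_funeM.
  exact: measurable_ind.
have F0 a X : 0 <= F a X by rewrite lee_fin expR_ge0.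
have EF a : a \in S -> 0 <= iint P L (F a) (@table0 R n) <= (expR (s * q + s ^+ 2 / 8))%:E.
  move=> aS; rewrite iint_ge0//= FE iintD//; last 2 first.
  - by apply: measurable_funeM; exact: measurable_ind.
  - by move=> X; rewrite mule_ge0 ?lee_fin// ind_ge0.
  rewrite iint_cst// iintZl//; last 2 first.
  - exact: measurable_ind.
  - by move=> X; exact: ind_ge0.
  apply: (@le_trans _ _ (1 + (expR s - 1)%:E * q%:E)).
    by apply: leeD => //; apply: lee_wpmul2l; [rewrite lee_fin|exact: bq].
  rewrite -EFinM -EFinD lee_fin.
  apply: le_trans (hoeffding_exp s _); last by rewrite q0.
  by rewrite le_eqVlt; apply/orP; left; apply/eqP; ring.
pose K : R := expR (- (s * ((q + phi / 2) * N))).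
apply: (@le_trans _ _ (iint P L (fun X => K%:E * \prod_(a <- S) F a X) (@table0 R n))).
  apply: markov.
  - apply: measurable_fun_ler => //.
    exact: measurable_count.
  - by apply: measurable_funeM; exact: emeasurable_prod.
  - by move=> X; rewrite mule_ge0 ?prode_ge0// lee_fin expR_ge0.
  - move=> X NX; rewrite prodEFin -expR_sum -EFinM -expRD lee_fin -[leLHS]expR0 ler_expR.
    have -> : (\sum_(a <- S) s * (b a X)%:R = s * (count (b^~ X) S)%:R)%R.
      by rewrite -mulr_sumr countE.
    by rewrite addrC subr_ge0 ler_wpM2l.
rewrite iintZl ?lee_fin ?expR_ge0//; last 2 first.
- exact: emeasurable_prod.
- by move=> X; exact: prode_ge0.
rewrite (@iint_prod R n P _ _ A)//; last first.
  by move=> a; rewrite /F => X Y XY; rewrite (rb a X Y XY).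
apply: (@le_trans _ _ (K%:E * (expR (s * q + s ^+ 2 / 8) ^+ size S)%:E)).
  apply: lee_wpmul2l; first by rewrite lee_fin expR_ge0.
  by apply: prode_le_exprn; rewrite ?expR_ge0.
rewrite -EFinM lee_fin -expRM_natl -expRD ler_expR.
apply: (@le_trans _ _ (- (s * ((q + phi / 2) * N)) + N * (s * q + s ^+ 2 / 8))%R).
  by rewrite lerD2l ler_wpM2r// addr_ge0 ?mulr_ge0 ?sqr_ge0.
by rewrite le_eqVlt; apply/orP; left; apply/eqP; rewrite /s; field.
Qed.

End prob_events.

(** * Elimination rounds *)

Section ranking.
Context {R : realType} {n : nat}.
Implicit Types (f : 'I_n -> R) (S : {set 'I_n}).

Lemma mem_sorted_by f S a : (a \in sorted_by f S) = (a \in S).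
Proof. by rewrite mem_sort mem_enum. Qed.

Lemma sorted_by_uniq f S : uniq (sorted_by f S).
Proof. by rewrite sort_uniq enum_uniq. Qed.

Lemma size_sorted_by f S : size (sorted_by f S) = #|S|.
Proof. by rewrite size_sort -cardE. Qed.

Lemma sorted_by_sorted f S : sorted (fun a b => f b <= f a) (sorted_by f S).
Proof. by apply: sort_sorted => a b; exact: le_total. Qed.

Lemma sorted_by_pairwise f S : pairwise (fun a b => f b <= f a) (sorted_by f S).
Proof.
rewrite -sorted_pairwise ?sorted_by_sorted// => b a c /= ba cb.
exact: le_trans cb ba.
Qed.

Lemma card_top k f S : #|top k f S| = minn k #|S|.
Proof.
rewrite /top cardsE; rewrite (card_uniqP _) ?take_uniq ?sorted_by_uniq//.
by rewrite size_take_min size_sorted_by.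
Qed.

(** Every arm sorted before [a] has a value at least [f a], so together with [a] itself at most [k]
    arms occupy the positions up to that of [a], however ties are broken. *)
Lemma mem_top k f S a : a \in S ->
  (count (fun b => f a <= f b)%R (enum S) <= k)%N -> a \in top k f S.
Proof.
move=> aS; rewrite inE /=.
have -> : count (fun b => f a <= f b)%R (enum S) = count (fun b => f a <= f b) (sorted_by f S).
  by apply/esym/permP; rewrite perm_sort.
have : a \in sorted_by f S by rewrite mem_sorted_by.
move: (sorted_by_pairwise f S) (sorted_by_uniq f S) => /[swap] + /[swap] as_.
case/splitPr: as_ => p1 p2 us; rewrite pairwise_cat => /and3P[/allrelP p1a _ _].
rewrite in_take; last by rewrite mem_cat mem_head orbT.
rewrite count_cat => cp; apply: leq_trans cp; rewrite index_cat.
have /negbTE -> : a \notin p1.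
  by apply: contraTN us => ap1; rewrite cat_uniq/= ap1 !andbF.
rewrite index_head addn0 /= lexx addnA addn1 (leq_trans _ (leq_addr _ _))// ltnS.
by rewrite (eq_in_count (a2 := predT)) ?count_predT// => b bp1; rewrite p1a// mem_head.
Qed.

Lemma ohead_sorted_by f S : (0 < #|S|)%N ->
  exists a, [/\ ohead (sorted_by f S) = Some a, a \in S & forall b, b \in S -> f b <= f a].
Proof.
move=> S0; have := sorted_by_pairwise f S.
have := size_sorted_by f S; have mS := mem_sorted_by f S.
case E : (sorted_by f S) => [|a s] /=; first by move=> sS; rewrite -sS in S0.
move=> _ /andP[/allP as_ _]; exists a; split => //.
  by rewrite -mS E mem_head.
move=> b; rewrite -mS E in_cons => /orP[/eqP->//|]; exact: as_.
Qed.

Lemma top1 f S : (0 < #|S|)%N ->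
  exists a, [/\ top 1 f S = [set a]%SET, a \in S & forall b, b \in S -> f b <= f a].
Proof.
move=> S0; have [a [ha aS amax]] := ohead_sorted_by f S0; exists a; split => //.
apply/setP => b; rewrite !inE; case: (sorted_by f S) ha => //= c s [->].
by rewrite take0 mem_seq1.
Qed.

End ranking.

Section finite_dependence.
Context {R : realType} {n : nat}.

Lemma sorted_byE (f : 'I_n -> R) (S : {set 'I_n}) :
  sorted_by f S = sort (fun a b => [ffun ab : 'I_n * 'I_n => f ab.2 <= f ab.1] (a, b)) (enum S).
Proof. by rewrite /sorted_by; congr sort; apply/funext => a; apply/funext => b; rewrite ffunE. Qed.

Lemma measurable_top k p m (S S' : {set 'I_n}) :
  measurable_fun [set: mtable R n] (fun X => top k (emp X p m) S == S').
Proof.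
pose h (v : {ffun 'I_n * 'I_n -> bool}) :=
  [set a in take k (sort (fun a b => v (a, b)) (enum S))]%SET.
rewrite (_ : (fun X => _) = fun X =>
  h [ffun ab : 'I_n * 'I_n => (emp X p m ab.2 <= emp X p m ab.1)%R] == S'); last first.
  by apply/funext => X; rewrite /top sorted_byE.
apply: (@measurable_finite _ (mtable R n) _ _
  (fun ab X => (emp X p m ab.2 <= emp X p m ab.1)%R) h) => ab.
by apply: measurable_fun_ler; exact: measurable_emp.
Qed.

Lemma measurable_winner p m (S : {set 'I_n}) (w : option 'I_n -> bool) :
  measurable_fun [set: mtable R n] (fun X => w (ohead (sorted_by (emp X p m) S))).
Proof.
pose h (v : {ffun 'I_n * 'I_n -> bool}) :=
  w (ohead (sort (fun a b => v (a, b)) (enum S))).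
rewrite (_ : (fun X => _) = fun X =>
  h [ffun ab : 'I_n * 'I_n => (emp X p m ab.2 <= emp X p m ab.1)%R] == true); last first.
  by apply/funext => X; rewrite eqb_id sorted_byE.
apply: (@measurable_finite _ (mtable R n) _ _
  (fun ab X => (emp X p m ab.2 <= emp X p m ab.1)%R) h) => ab.
by apply: measurable_fun_ler; exact: measurable_emp.
Qed.

End finite_dependence.

Section elimination_process.
Context {R : realType} {n : nat} (pr : params R) (eps : R).

Definition small (S : {set 'I_n}) := #|S|%:R <= ((n%:R : R) `^ (3 / 4 : R)) / 2.

Definition kept (S : {set 'I_n}) := Defs.ceilN ((dprime pr + phi pr) * #|S|%:R).

Definition step (i : nat) (X : table R n) (S : {set 'I_n}) :=
  if small S then S else top (kept S) (emp X i (round_samples pr eps i)) S.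

(** The elimination run forward from the full set, and frozen instead of stopped once the set is
    small. In this form the arms entering round [i] are visibly a function of the draws of earlier
    phases. *)
Fixpoint survivors (i : nat) (X : table R n) : {set 'I_n} :=
  if i is i'.+1 then step i' X (survivors i' X) else [set: 'I_n]%SET.

Lemma survivors_stable k j X : small (survivors j X) -> survivors (j + k) X = survivors j X.
Proof. by move=> sj; elim: k => [|k IH]; rewrite ?addn0// addnS /= IH /step sj. Qed.

Lemma elim_survivors X fuel i :
  (elim pr eps X fuel i (survivors i X)).1 = survivors (i + fuel) X.
Proof.
elim: fuel i => [|fuel IH] i; first by rewrite addn0.
rewrite [LHS]/= -/(small _); case: ifPn => [s|/negbTE sN]; first by rewrite survivors_stable.
by rewrite addnS -addSn -IH /= /step sN.
Qed.

Lemma emp_reads p m : reads (fun c => c.1.2 == p) (fun X : mtable R n => emp X p m).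
Proof.
move=> X Y XY; apply/funext => a; rewrite /emp; congr (_ / _).
by apply: eq_bigr => j _; exact: (XY (a, p, j : nat) (eqxx p)).
Qed.

Lemma survivors_reads i : reads (fun c => (c.1.2 < i)%N) (survivors i : mtable R n -> _).
Proof.
elim: i => // i IH X Y XY /=; rewrite (IH X Y); last by move=> c ci; apply: XY; exact: ltnW.
rewrite /step; case: ifP => // _; rewrite (@emp_reads _ _ X Y)// => c /eqP ci.
by apply: XY; rewrite ci.
Qed.

Lemma measurable_survivors i S :
  measurable_fun [set: mtable R n] (fun X => survivors i X == S).
Proof.
elim: i S => [|i IH] S; first by rewrite (_ : (fun X => _) = cst ([set: 'I_n]%SET == S))//.
rewrite (_ : (fun X => _) = fun X =>
  has (fun S' => (survivors i X == S') && (step i X S' == S)) (enum {set 'I_n})); last first.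
  apply/funext => X; apply/idP/hasP => [h|[S' _ /andP[/eqP <- //]]].
  by exists (survivors i X); rewrite ?mem_enum// eqxx.
apply: (@measurable_has _ (mtable R n) _ _
  (fun S' X => (survivors i X == S') && (step i X S' == S))) => S'.
apply: measurable_and => //; rewrite /step.
case: (small S') => /=; first exact: measurable_cst.
exact: measurable_top.
Qed.

Lemma survivors_hasE i (C : {set 'I_n} -> mtable R n -> bool) :
  (fun X => C (survivors i X) X) =
  (fun X => has (fun S => (survivors i X == S) && C S X) (enum {set 'I_n})).
Proof.
apply/funext => X; apply/idP/hasP => [h|[S' _ /andP[/eqP <- //]]].
by exists (survivors i X); rewrite ?mem_enum// eqxx.
Qed.

Lemma measurable_adapted i (C : {set 'I_n} -> mtable R n -> bool) :
  (forall S, measurable_fun [set: mtable R n] (C S)) ->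
  measurable_fun [set: mtable R n] (fun X => C (survivors i X) X).
Proof.
move=> mC; rewrite survivors_hasE.
apply: (@measurable_has _ (mtable R n) _ _ (fun S X => (survivors i X == S) && C S X)) => S.
by apply: measurable_and => //; exact: measurable_survivors.
Qed.

(* The draws of phase [i] are independent of the set [survivors i] of arms
   entering it, so that set can be treated as fixed. *)
Lemma Pr_adapted (P : arm_instance R n) L i (C : {set 'I_n} -> mtable R n -> bool) (eta : R) :
  (forall S, measurable_fun [set: mtable R n] (C S)) ->
  (forall S, reads (fun c => c.1.2 == i) (C S)) ->
  (forall S, (Pr P L (C S) <= eta%:E)%E) ->
  (Pr P L (fun X => C (survivors i X) X) <= eta%:E)%E.
Proof.
move=> mC rC CE; rewrite survivors_hasE.
have msC S : measurable_fun [set: mtable R n] (fun X => (survivors i X == S) && C S X).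
  by apply: measurable_and => //; exact: measurable_survivors.
apply: (le_trans (Pr_has _ _ _ msC)).
have eta0 : 0 <= eta by rewrite -lee_fin (le_trans _ (CE [set: 'I_n]%SET))// Pr_ge0.
apply: (@le_trans _ _
    (\sum_(S <- enum {set 'I_n}) eta%:E * Pr P L (fun X => survivors i X == S))%E).
  apply: lee_sum => S _; rewrite muleC.
  rewrite (@Pr_indep _ _ _ _ (fun c => (c.1.2 < i)%N) (fun c => c.1.2 == i))//.
  - by apply: lee_wpmul2l => //; exact: Pr_ge0.
  - exact: measurable_survivors.
  - by move=> X Y XY; rewrite (survivors_reads XY).
  - by move=> c; apply/negP => /andP[/= ci /eqP ci2]; rewrite ci2 ltnn in ci.
rewrite -ge0_sume_distrr; last by move=> S _; exact: Pr_ge0.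
rewrite -[leRHS]mule1; apply: lee_wpmul2l; first by rewrite lee_fin.
rewrite /Pr -iint_sum; last 2 first.
- by move=> S; apply: measurable_ind; exact: measurable_survivors.
- by move=> S X; exact: ind_ge0.
rewrite -[leRHS](iint_cst P L (@table0 R n) lee01); apply: le_iint => //.
- by apply: emeasurable_sum => S; apply: measurable_ind; exact: measurable_survivors.
- by move=> X; apply: sume_ge0 => S _; exact: ind_ge0.
- move=> X; rewrite big_enum/= (bigD1 (survivors i X))//= big1 /ind ?eqxx ?adde0//.
  by move=> S /negbTE; rewrite eq_sym => ->.
Qed.

End elimination_process.
Arguments small R {n} S.

(** * Probability of success *)

Section ceilN_bounds.
Context {R : realType}.
Implicit Types x : R.

Lemma ceilN_ge x : x <= (Defs.ceilN x)%:R.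
Proof.
apply: le_trans (ceil_ge x) _; rewrite /Defs.ceilN natr_absz ler_int.
exact: ler_norm.
Qed.

Lemma ceilN_lt x : 0 <= x -> (Defs.ceilN x)%:R < x + 1.
Proof.
move=> x0; rewrite /Defs.ceilN natr_absz ger0_norm.
  by rewrite -ltrBlDr -[1]/(1%:~R) -rmorphB/= ceilB1_lt.
by rewrite ceil_ge0 (lt_le_trans _ x0)// ltrN10.
Qed.

Lemma ceilN_gt0 x : 0 < x -> (0 < Defs.ceilN x)%N.
Proof. by move=> x0; rewrite -(ltr_nat R) (lt_le_trans x0)// ceilN_ge. Qed.

Lemma ceilN_le x (k : nat) : 0 <= x -> x <= k%:R -> (Defs.ceilN x <= k)%N.
Proof.
move=> x0 xk; rewrite -ltnS -(ltr_nat R) (lt_le_trans (ceilN_lt x0))//.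
by rewrite -natr1 lerD2r.
Qed.

(** Converts a sample size into a confidence: [2 * m * t ^+ 2 >= m * c ^+ 2 / 2 >= ln (1 / q)]. *)
Lemma expR_tail (m c t q : R) : 0 < c -> 0 < q -> c ^+ 2 <= (2 * t) ^+ 2 -> 0 <= m ->
  2 / c ^+ 2 * ln (1 / q) <= m -> expR (- (2 * m * t ^+ 2)) <= q.
Proof.
move=> c0 q0 ct m0 cm.
rewrite -[leRHS]lnK ?posrE// ler_expR -lerN2 opprK -[in leLHS]lnV ?posrE// -div1r.
have : 2 / c ^+ 2 * ln (1 / q) * c ^+ 2 <= m * c ^+ 2.
  by rewrite ler_wpM2r// sqr_ge0.
rewrite mulrAC divfK ?expf_neq0 ?gt_eqF// => h.
have : m * c ^+ 2 <= m * (2 * t) ^+ 2 by exact: ler_wpM2l.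
by rewrite exprMn; nra.
Qed.

End ceilN_bounds.

Section success_analysis.
Context {R : realType} {n : nat} (P : arm_instance R n) (pr : params R) (eps : R).
Variables (L : seq ('I_n * nat * nat)) (astar : 'I_n).
Hypotheses (P01 : supported01 P) (eps0 : 0 < eps).
Hypotheses (alp01 : 0 < alpha pr < 1) (dp01 : 0 < dprime pr < 1).
Hypotheses (dpp01 : 0 < dsecond pr < 1) (phi0 : 0 <= phi pr).
Hypothesis astar_max : forall b, arm_mean P b <= arm_mean P astar.

Let m := round_samples pr eps.
Let mu := arm_mean P.
Let c := alpha pr * eps.
Let c' := (1 - alpha pr) * eps.

Definition final_samples (k : nat) : nat :=
  Defs.ceilN (2 / ((1 - alpha pr) * eps) ^+ 2 * ln (k%:R / dsecond pr)).

Hypothesis roundsL : forall a i j, (i < n.+1)%N -> (j < m i)%N -> (a, i, j) \in L.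
Hypothesis finalL : forall a k j, (k <= n)%N -> (j < final_samples k)%N -> (a, n.+2, j) \in L.

Let c0 : 0 < c. Proof. by case/andP: alp01 => a0 a1; rewrite mulr_gt0. Qed.
Let c'0 : 0 < c'. Proof. by case/andP: alp01 => a0 a1; rewrite mulr_gt0// subr_gt0. Qed.

Let lndp : 0 < ln (1 / dprime pr).
Proof. by case/andP: dp01 => d0 d1; rewrite ln_gt0// ltr_pdivlMr// mul1r. Qed.

Let m_gt0 i : (0 < m i)%N.
Proof.
rewrite muln_gt0/=; apply: ceilN_gt0; rewrite mulr_gt0// divr_gt0// exprn_gt0//.
Qed.

(** Round [i] takes [i.+1] times the base number of samples, which raises the failure probability to
    the power [i.+1] and makes the failures summable over rounds. *)
Let round_tail i t : c ^+ 2 <= (2 * t) ^+ 2 ->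
  expR (- (2 * (m i)%:R * t ^+ 2)) <= dprime pr ^+ i.+1.
Proof.
case/andP: dp01 => d0 d1 ct; apply: (expR_tail c0) => //; first exact: exprn_gt0.
rewrite /m /round_samples natrM div1r -[(dprime pr ^+ _)^-1]exprVn lnXn ?invr_gt0//.
rewrite [leLHS]mulrnAr -[leLHS]mulr_natl.
have h := ceilN_ge (2 / c ^+ 2 * ln (1 / dprime pr)).
by apply: ler_wpM2l => //; apply: le_trans h; rewrite div1r.
Qed.

Let k_dpp k : (0 < k)%N -> ln (1 / dsecond pr) <= ln (k%:R / dsecond pr).
Proof.
case/andP: dpp01 => d0 d1 k0.
rewrite ler_ln ?posrE ?divr_gt0 ?ltr0n// ler_pM2r ?invr_gt0//.
by rewrite (ler_nat _ 1 k).
Qed.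

Let final_gt0 k : (0 < k)%N -> (0 < final_samples k)%N.
Proof.
case/andP: dpp01 => d0 d1 k0; apply: ceilN_gt0.
rewrite mulr_gt0 ?divr_gt0 ?exprn_gt0//.
by apply: lt_le_trans (k_dpp k0); rewrite ln_gt0// ltr_pdivlMr// mul1r.
Qed.

Let final_tail k t : (0 < k)%N -> c' ^+ 2 <= (2 * t) ^+ 2 ->
  expR (- (2 * (final_samples k)%:R * t ^+ 2)) <= dsecond pr.
Proof.
case/andP: dpp01 => d0 d1 k0 ct; apply: (expR_tail c'0) => //.
apply: le_trans (ceilN_ge _); apply: ler_wpM2l (k_dpp k0).
by rewrite divr_ge0// sqr_ge0.
Qed.

Definition good (a : 'I_n) := mu astar - c <= mu a.

Definition off (p k : nat) (t : R) (a : 'I_n) (X : mtable R n) :=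
  (mu a + t <= emp X p k a) || (emp X p k a <= mu a - t).

Lemma measurable_off p k t a : measurable_fun [set: mtable R n] (off p k t a).
Proof.
by apply: measurable_or; apply: measurable_fun_ler => //; exact: measurable_emp.
Qed.

Let Pr_off p k t a q : (0 < k)%N -> 0 <= t -> expR (- (2 * k%:R * t ^+ 2)) <= q ->
  (forall j, (j < k)%N -> (a, p, j) \in L) ->
  (Pr P L (off p k t a) <= (2 * q)%:E)%E.
Proof.
move=> k0 t0 qE inL.
pose B (b : bool) X := if b then mu a + t <= emp X p k a else emp X p k a <= mu a - t.
have mB b : measurable_fun [set: mtable R n] (B b).
  by case: b; apply: measurable_fun_ler => //; exact: measurable_emp.
have := @Pr_has _ _ P L _ [:: true; false] B mB.
rewrite big_cons big_seq1 /= => h.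
have -> : off p k t a = fun X => B true X || (B false X || false).
  by apply/funext => X; rewrite orbF.
apply: (le_trans h); rewrite mulr_natl mulr2n EFinD; apply: leeD.
  apply: (le_trans (emp_ge_tail _ _ _ _)) => //; first by rewrite lerDl.
  by rewrite lee_fin -/mu addrAC subrr add0r.
apply: (le_trans (emp_le_tail _ _ _ _)) => //; first by rewrite lerBlDr lerDl.
by rewrite lee_fin -/mu addrAC subrr add0r sqrrN.
Qed.

(** The final set, and hence the number of samples per arm, is random. Ranging over all arms and all
    sizes [k] gives one event that covers every possible final set. *)
Definition final_bad (X : mtable R n) :=
  has (fun ka => off n.+2 (final_samples ka.1) (c' / 2) ka.2 X)
    [seq (k, a) | k <- iota 1 n, a <- enum 'I_n].

Lemma measurable_final_bad : measurable_fun [set: mtable R n] final_bad.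
Proof.
apply: (@measurable_has _ (mtable R n) _ _
  (fun ka X => off n.+2 (final_samples ka.1) (c' / 2) ka.2 X)) => ka.
exact: measurable_off.
Qed.

Lemma sume_le_size (I : eqType) (s : seq I) (F : I -> \bar R) (q : R) :
  (forall i, i \in s -> F i <= q%:E)%E -> (\sum_(i <- s) F i <= ((size s)%:R * q)%:E)%E.
Proof.
move=> Fq; apply: (@le_trans _ _ (\sum_(i <- s) q%:E)%E).
  by rewrite big_seq [leRHS]big_seq; apply: lee_sum.
rewrite sumEFin lee_fin big_const_seq count_predT iter_addr_0 mulr_natl//.
Qed.

Lemma Pr_final_bad : (Pr P L final_bad <= ((n * n)%:R * (2 * dsecond pr))%:E)%E.
Proof.
apply: (le_trans (Pr_has _ _ _ (fun ka => measurable_off _ _ _ _))).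
apply: (le_trans (sume_le_size (q := 2 * dsecond pr) _)).
  move=> [k a] /allpairsP[[k' a'] /= [kn _ [-> ->]]].
  move: kn; rewrite mem_iota add1n ltnS => /andP[k0 kn].
  apply: Pr_off.
  - exact: final_gt0.
  - by rewrite divr_ge0// ltW.
  - by apply: final_tail => //; rewrite mulrCA divff// mulr1.
  - by move=> j; exact: finalL.
by rewrite size_allpairs size_iota -cardE card_ord.
Qed.

(** All final estimates are within [c' / 2], so the winner loses less than [c'] against the good arm
    [g], which itself loses at most [c]; and [c + c' = eps]. *)
Lemma aba_success Rs X : ~~ final_bad X ->
  (exists2 g, g \in survivors pr eps n.+1 X :|: Rs & good g) ->
  success P eps (aba pr eps Rs X).1.
Proof.
move=> fb [g gB gg]; rewrite /aba.
have -> : elim pr eps X n.+1 0 [set: 'I_n]%SET =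
    elim pr eps X n.+1 0 (survivors pr eps 0 X) by [].
rewrite elim_survivors add0n /=; set B := _ :|: Rs in gB *.
have B0 : (0 < #|B|)%N by apply/card_gt0P; exists g.
have [a [-> aB amax]] := ohead_sorted_by (emp X n.+2 (final_samples #|B|)) B0.
have acc b : ~~ off n.+2 (final_samples #|B|) (c' / 2) b X.
  move/hasPn: fb => /(_ (#|B|, b)); apply; apply/allpairsP; exists (#|B|, b).
  rewrite mem_iota add1n ltnS B0 mem_enum /=; split => //.
  by rewrite -[leqRHS]card_ord max_card.
have := acc a; have := acc g; rewrite /off !negb_or -!ltNge => /andP[_ g2] /andP[a1 _].
apply/asboolP => b; rewrite -/mu; have := astar_max b; rewrite -/mu.
have := amax g gB; move: gg; rewrite /good /c.
have : c' = eps - alpha pr * eps by rewrite /c'; ring.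
by lra.
Qed.

Lemma measurable_success Rs :
  measurable_fun [set: mtable R n] (fun X => success P eps (aba pr eps Rs X).1).
Proof.
pose C (S : {set 'I_n}) (X : mtable R n) := success P eps (ohead (sorted_by
   (emp X n.+2 (final_samples #|S :|: Rs|)) (S :|: Rs))).
rewrite (_ : (fun X => _) = fun X => C (survivors pr eps n.+1 X) X).
  by apply: measurable_adapted => S; exact: measurable_winner.
apply/funext => X; rewrite /aba.
have -> : elim pr eps X n.+1 0 [set: 'I_n]%SET =
    elim pr eps X n.+1 0 (survivors pr eps 0 X) by [].
by rewrite elim_survivors add0n.
Qed.

Lemma success_ge Rs (bad : mtable R n -> bool) (q : R) :
  measurable_fun [set: mtable R n] bad -> (Pr P L bad <= q%:E)%E ->
  (forall X, ~~ bad X -> success P eps (aba pr eps Rs X).1) ->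
  ((1 - q)%:E <= Pr P L (fun X => success P eps (aba pr eps Rs X).1))%E.
Proof.
move=> mb bq bs.
apply: (@le_trans _ _ (Pr P L (fun X => ~~ bad X))); last first.
  by apply: le_Pr => //; [exact: measurable_neg|exact: measurable_success].
have h := PrC P L mb; have h0 := Pr_ge0 P L bad; have h1 := Pr_ge0 P L (fun X => ~~ bad X).
move: h h0 h1 bq; case: (Pr _ _ bad) => [x| |]//; case: (Pr _ _ _) => [y| |]//.
by rewrite -EFinD !lee_fin => -[] h _ _ xq; lra.
Qed.

Lemma Pr_orb (b1 b2 : mtable R n -> bool) (q1 q2 : R) :
  measurable_fun [set: mtable R n] b1 -> measurable_fun [set: mtable R n] b2 ->
  (Pr P L b1 <= q1%:E)%E -> (Pr P L b2 <= q2%:E)%E ->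
  (Pr P L (fun X => b1 X || b2 X) <= (q1 + q2)%:E)%E.
Proof.
move=> m1 m2 h1 h2.
pose B (b : bool) := if b then b1 else b2.
have mB b : measurable_fun [set: mtable R n] (B b) by case: b.
have := @Pr_has _ _ P L _ [:: true; false] B mB.
rewrite big_cons big_seq1 /= => h.
have -> : (fun X => b1 X || b2 X) = fun X => B true X || (B false X || false).
  by apply/funext => X; rewrite orbF.
by apply: (le_trans h); rewrite EFinD; apply: leeD.
Qed.

(** Midway between the best mean and the threshold for good arms: the best arm and any bad arm must
    each deviate by at least [c / 2] to land on the wrong side. *)
Let theta := mu astar - c / 2.
Let G := [set a | good a]%SET.
Let K : R := n%:R `^ (3 / 4 : R).

Lemma count_enum (p : pred 'I_n) (S : {set 'I_n}) : count p (enum S) = #|[set a in S | p a]%SET|.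
Proof.
rewrite -sum1_count big_enum_cond/= -sum1_card.
by apply: eq_bigl => a; rewrite inE.
Qed.

Definition low i (X : mtable R n) := emp X i (m i) astar <= theta.

(** The set [S] is a parameter so that [Pr_adapted] can substitute the random survivors. Small sets
    are excluded because the probability bound relies on [#|S| > K / 2]. *)
Definition crowd i (S : {set 'I_n}) (X : mtable R n) := ~~ small R S &&
  ((dprime pr + phi pr / 2) * #|S|%:R <=
   (count (fun a => theta <= emp X i (m i) a) (enum (S :\: G)))%:R).

Lemma measurable_low i : measurable_fun [set: mtable R n] (low i).
Proof. by apply: measurable_fun_ler => //; exact: measurable_emp. Qed.

Lemma measurable_crowd i S : measurable_fun [set: mtable R n] (crowd i S).
Proof.
apply: measurable_and => //; apply: measurable_fun_ler => //.
apply: (@measurable_count R n _ (fun a X => theta <= emp X i (m i) a)) => a.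
by apply: measurable_fun_ler => //; exact: measurable_emp.
Qed.

Lemma crowd_reads i S : reads (fun x => x.1.2 == i) (crowd i S).
Proof. by move=> X Y XY; rewrite /crowd (emp_reads _ XY). Qed.

Lemma Pr_low i : (i < n.+1)%N -> (Pr P L (low i) <= (dprime pr ^+ i.+1)%:E)%E.
Proof.
move=> ni; apply: (le_trans (emp_le_tail _ _ _ _)) => //.
- by rewrite /theta gerBl divr_ge0// ltW.
- by move=> j; exact: roundsL.
- rewrite lee_fin; apply: round_tail; rewrite /theta -/mu le_eqVlt; apply/orP; left.
  by apply/eqP; field.
Qed.

Lemma Pr_crowd i S : (i < n.+1)%N ->
  (Pr P L (crowd i S) <= (expR (- (phi pr ^+ 2 * K / 4)))%:E)%E.
Proof.
move=> ni; have [sS|sS] := boolP (small R S).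
  rewrite (_ : Pr _ _ _ = 0)%E ?lee_fin ?expR_ge0//.
  rewrite -(iint_cst P L (@table0 R n) (lexx 0%E)); congr iint.
  by apply/funext => X; rewrite /ind /crowd sS.
have [d0 d1] := andP dp01.
pose b a (X : mtable R n) := theta <= emp X i (m i) a.
have mb a : measurable_fun [set: mtable R n] (b a).
  by apply: measurable_fun_ler => //; exact: measurable_emp.
apply: (@le_trans _ _ (Pr P L (fun X => (dprime pr + phi pr / 2) * #|S|%:R <=
   (count (b^~ X) (enum (S :\: G)))%:R))).
  apply: le_Pr; first exact: measurable_crowd.
    by apply: measurable_fun_ler => //; exact: measurable_count.
  by move=> X /andP[].
apply: (le_trans (count_tail (A := fun a x => (x.1.1 == a) && (x.1.2 == i)) _ mb _ _ _ _ phi0 _)).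
- exact: enum_uniq.
- move=> a X Y XY; rewrite /b /emp; congr (_ <= _ / _); apply: eq_bigr => j _.
  by apply: (XY (a, i, j : nat)); rewrite /= !eqxx.
- by move=> a a' x /andP[/eqP <- _] /andP[/eqP <- _].
- move=> a; rewrite mem_enum !inE => /andP[ga _].
  have {ga} : mu a < mu astar - c by rewrite ltNge.
  move=> ga; have tc : c / 2 <= theta - mu a by rewrite /theta; lra.
  apply: (le_trans (emp_ge_tail _ _ _ _)) => //.
  + by rewrite -subr_ge0 (le_trans _ tc)// divr_ge0// ltW.
  + by move=> j; exact: roundsL.
  + rewrite lee_fin -/mu; apply: (@le_trans _ _ (dprime pr ^+ i.+1)).
      apply: round_tail; rewrite lerXn2r ?nnegrE//; first exact: ltW.
        by rewrite mulr_ge0// (le_trans _ tc)// divr_ge0// ltW.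
      by rewrite mulrC -ler_pdivrMr.
    by rewrite exprS ger_pMr// exprn_ile1// ltW.
- by rewrite !ltW.
- by rewrite ler_nat -cardE subset_leq_card// subsetDl.
(* Since [#|S| > K / 2], the exponent [phi ^+ 2 * #|S| / 2] is at least [phi ^+ 2 * K / 4]. *)
- rewrite lee_fin ler_expR lerN2 -/K.
  move: sS; rewrite /small -ltNge -/K => /ltW sS.
  have := ler_wpM2l (sqr_ge0 (phi pr)) sS; lra.
Qed.

(** An arm that ranks at least as high as [astar] is either good or a bad arm above [theta]. In a
    set that is not small, [phi * K / 4] is at most [phi / 2 * #|S|], so both kinds together fit
    within [kept S]. *)
Lemma survives i X (S : {set 'I_n}) : astar \in S -> ~~ low i X -> ~~ crowd i S X ->
  (#|G|%:R <= phi pr * K / 4) -> astar \in step pr eps i X S.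
Proof.
move=> aS; rewrite /low /crowd /step -ltNge => alow.
case: ifPn => //= sS; rewrite -ltNge => cr Gs.
apply: mem_top => //; rewrite -(ler_nat R); apply: le_trans (ceilN_ge _).
have : (count (fun b => emp X i (m i) astar <= emp X i (m i) b)%R (enum S) <=
    count (fun a => theta <= emp X i (m i) a)%R (enum (S :\: G)) + #|G|)%N.
  rewrite !count_enum; apply: leq_trans (leq_card_setU _ _).
  apply/subset_leq_card/fintype.subsetP => a; rewrite !inE => /andP[-> h].
  by rewrite (le_trans (ltW alow) h) !andbT orNb.
rewrite -(ler_nat R) natrD => /le_trans; apply.
move: sS; rewrite /small -ltNge -/K => sS.
have := ler_wpM2l phi0 (ltW sS); lra.
Qed.

Definition elim_bad (X : mtable R n) :=
  has (fun i => low i X || crowd i (survivors pr eps i X) X) (iota 0 n.+1).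

Lemma elim_good X : ~~ elim_bad X -> #|G|%:R <= phi pr * K / 4 ->
  astar \in survivors pr eps n.+1 X.
Proof.
move=> /hasPn eb Gs; suff h i : (i <= n.+1)%N -> astar \in survivors pr eps i X by exact: h.
elim: i => [|i IH] ni; first by rewrite inE.
have := eb i; rewrite mem_iota add0n => /(_ ni); rewrite negb_or => /andP[li ci].
by apply: survives => //; exact/IH/ltnW.
Qed.

Let measurable_elim_bad1 i : measurable_fun [set: mtable R n]
  (fun X => low i X || crowd i (survivors pr eps i X) X).
Proof.
apply: measurable_or; first exact: measurable_low.
by apply: measurable_adapted => S; exact: measurable_crowd.
Qed.

Lemma Pr_elim_bad : dprime pr <= 1 / 2 ->
  (Pr P L elim_bad <= (2 * dprime pr + n.+1%:R * expR (- (phi pr ^+ 2 * K / 4)))%:E)%E.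
Proof.
move=> d2; have [d0 d1] := andP dp01.
apply: (le_trans (Pr_has _ _ _ measurable_elim_bad1)).
apply: (@le_trans _ _ (\sum_(i <- iota 0 n.+1)
    (dprime pr ^+ i.+1 + expR (- (phi pr ^+ 2 * K / 4)))%:E)%E).
  rewrite big_seq [leRHS]big_seq; apply: lee_sum => i; rewrite mem_iota add0n => /andP[_ ni].
  apply: Pr_orb; [exact: measurable_low| |exact: Pr_low|].
    by apply: measurable_adapted => S; exact: measurable_crowd.
  apply: Pr_adapted => S; [exact: measurable_crowd|exact: crowd_reads|exact: Pr_crowd].
rewrite sumEFin lee_fin big_split; apply: lerD; last first.
  by rewrite big_const_seq count_predT size_iota iter_addr_0 mulr_natl.
(* The geometric sum, with the factor [1 - dprime ^+ k] kept so that the induction goes through. *)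
suff h : forall k, \sum_(i <- iota 0 k) dprime pr ^+ i.+1 <= 2 * dprime pr * (1 - dprime pr ^+ k).
  by apply: (le_trans (h _)); rewrite ger_pMr ?mulr_gt0// gerBl exprn_ge0// ltW.
elim=> [|k IH]; first by rewrite big_nil expr0 subrr mulr0.
rewrite -addn1 iotaD add0n big_cat/= big_seq1 addn1.
have x0 := exprn_ge0 k (ltW d0); move: IH; rewrite exprS.
have d2' : 0 <= 1 / 2 - dprime pr by rewrite subr_ge0.
have := mulr_ge0 (mulr_ge0 (ltW d0) x0) d2'.
set x := dprime pr ^+ k; set y := \sum_(_ <- _) _; set d := dprime pr; lra.
Qed.

Lemma success_few_good Rs : dprime pr <= 1 / 2 -> #|G|%:R <= phi pr * K / 4 ->
  ((1 - ((2 * dprime pr + n.+1%:R * expR (- (phi pr ^+ 2 * K / 4))) +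
         (n * n)%:R * (2 * dsecond pr)))%:E
   <= Pr P L (fun X => success P eps (aba pr eps Rs X).1))%E.
Proof.
move=> d2 Gs; apply: (success_ge (bad := fun X => elim_bad X || final_bad X)).
- apply: measurable_or; last exact: measurable_final_bad.
  exact: (measurable_has (T := mtable R n)).
- apply: Pr_orb; [|exact: measurable_final_bad|exact: Pr_elim_bad|exact: Pr_final_bad].
  exact: (measurable_has (T := mtable R n)).
- move=> X; rewrite negb_or => /andP[eb fb]; apply: aba_success => //.
  exists astar; first by rewrite inE elim_good.
  by rewrite /good gerBl ltW.
Qed.

Lemma success_hit (Rs : {set 'I_n}) g : g \in Rs -> good g ->
  ((1 - (n * n)%:R * (2 * dsecond pr))%:E
   <= Pr P L (fun X => success P eps (aba pr eps Rs X).1))%E.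
Proof.
move=> gR gg; apply: (success_ge (bad := final_bad)).
- exact: measurable_final_bad.
- exact: Pr_final_bad.
- by move=> X fb; apply: aba_success => //; exists g => //; rewrite inE gR orbT.
Qed.

Definition sample_bad (X : mtable R n) := has (fun a => off 0 (m 0) (c / 2) a X) (enum 'I_n).

(** Round 0 leaves a single arm, and [1 <= K / 2] makes that singleton small, so it stays until the
    end. It is good because its estimate and that of [astar] are both within [c / 2]. *)
Lemma success_one_round Rs : kept pr [set: 'I_n]%SET = 1%N ->
  ~~ small R [set: 'I_n]%SET -> 1 <= K / 2 ->
  ((1 - (n%:R * (2 * dprime pr) + (n * n)%:R * (2 * dsecond pr)))%:E
   <= Pr P L (fun X => success P eps (aba pr eps Rs X).1))%E.
Proof.
move=> k1 nsm K2.
have msb : measurable_fun [set: mtable R n] sample_bad.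
  by apply: (measurable_has (T := mtable R n)) => a; exact: measurable_off.
have [d0 d1] := andP dp01.
apply: (success_ge (bad := fun X => sample_bad X || final_bad X)).
- by apply: measurable_or; last exact: measurable_final_bad.
- apply: Pr_orb => //; [exact: measurable_final_bad| |exact: Pr_final_bad].
  apply: (le_trans (Pr_has _ _ _ (fun a => measurable_off _ _ _ a))).
  apply: (le_trans (sume_le_size (q := 2 * dprime pr) _)).
    move=> a _; apply: Pr_off => //.
    + by rewrite divr_ge0// ltW.
    + by rewrite -[leRHS]expr1; apply: round_tail; rewrite mulrCA divff// mulr1.
    + by move=> j; exact: roundsL.
  by rewrite -cardE card_ord.
- move=> X; rewrite negb_or => /andP[/hasPn sb fb]; apply: aba_success => //.
  have n0 : (0 < #|[set: 'I_n]%SET|)%N by apply/card_gt0P; exists astar.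
  have [a [ta _ amax]] := top1 (emp X 0 (m 0)) n0.
  have s1 : survivors pr eps 1 X = [set a]%SET.
    by rewrite /= /step (negbTE nsm) k1 ta.
  have sN : survivors pr eps n.+1 X = [set a]%SET.
    by rewrite -add1n survivors_stable s1// /small cards1 -/K.
  exists a; first by rewrite sN !inE eqxx.
  have := amax astar (finset.in_setT _).
  have := sb astar; rewrite mem_enum => /(_ isT); rewrite /off negb_or -!ltNge => /andP[_].
  have := sb a; rewrite mem_enum => /(_ isT); rewrite /off negb_or -!ltNge => /andP[+ _].
  by rewrite /good; lra.
Qed.

End success_analysis.

(** * Sample complexity *)

Section sample_complexity.
Context {R : realType} {n : nat} (pr : params R) (eps : R) (rho : R).
Hypothesis rho14 : 0 <= rho <= 1 / 4.
Hypothesis kept_le : forall S : {set 'I_n}, ~~ small R S -> (kept pr S)%:R <= rho * #|S|%:R.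
(** The sum of the geometric series of ratio [2 * rho], used through the fixed-point equation
    [kap = 1 + 2 * rho * kap]. *)
Let kap := (1 - 2 * rho)^-1.
Let m0 := round_samples pr eps 0.

(* The cost [i.+1 * #|S| * m0] of round [i] dominates the rest because [#|S|]
   shrinks by [rho] while the factor [i.+1] at most doubles. *)
Lemma elim_cost X fuel i (S : {set 'I_n}) :
  (elim pr eps X fuel i S).2%:R <= i.+1%:R * kap * #|S|%:R * m0%:R.
Proof.
have /andP[r0 r1] := rho14.
have k0 : 0 < 1 - 2 * rho by lra.
have kap0 : 0 < kap by rewrite invr_gt0.
elim: fuel i S => [|fuel IH] i S; first by rewrite !mulr_ge0// ltW.
rewrite [elim _ _ _ _ _ _]/= -/(small R S); case: ifPn => [_|sS].
  by rewrite !mulr_ge0// ltW.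
rewrite [_.2]/= natrD; set S' := top _ _ _.
have S'S : #|S'|%:R <= rho * #|S|%:R.
  apply: le_trans (kept_le sS); rewrite ler_nat /S' card_top; exact: geq_minl.
apply: (le_trans (lerD (lexx _) (IH i.+1 S'))).
have mE : (round_samples pr eps i)%:R = i.+1%:R * m0%:R :> R.
  by rewrite /m0 /round_samples mul1n natrM.
rewrite natrM mE.
have kE : kap = 1 + 2 * rho * kap by rewrite /kap; field; rewrite gt_eqF.
have i2 : i.+2%:R <= 2 * i.+1%:R :> R by rewrite -natrM ler_nat; lia.
have h : i.+2%:R * kap * #|S'|%:R * m0%:R <= (2 * i.+1%:R) * kap * (rho * #|S|%:R) * m0%:R.
  apply: ler_wpM2r => //; apply: ler_pM => //; first by rewrite mulr_ge0// ltW.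
  by rewrite ler_pM2r.
apply: (le_trans (lerD (lexx _) h)).
rewrite [in leRHS]kE le_eqVlt; apply/orP; left; apply/eqP; ring.
Qed.

(** Each executed round strictly shrinks the set, so the fuel cannot run out before the stopping
    condition is met. *)
Lemma elim_small X fuel i (S : {set 'I_n}) : (#|S| <= fuel)%N ->
  small R (elim pr eps X fuel i S).1.
Proof.
elim: fuel i S => [|fuel IH] i S Sf.
  by move: Sf; rewrite leqn0 => /eqP S0; rewrite /small /= S0 divr_ge0// powR_ge0.
rewrite [elim _ _ _ _ _ _]/= -/(small R S); case: ifPn => [//|sS].
apply: IH; rewrite -ltnS (leq_trans _ Sf)// card_top (leq_ltn_trans (geq_minl _ _))//.
rewrite -(ltr_nat R) (le_lt_trans (kept_le sS))//.
have S0 : 0 < #|S|%:R :> R.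
  move: sS; rewrite /small -ltNge; apply: le_lt_trans.
  by rewrite divr_ge0// powR_ge0.
by have /andP[r0 r1] := rho14; nra.
Qed.

(** The witness [b] is the size of the final set, which also determines the number of samples per
    arm there. *)
Lemma aba_cost (Rs : {set 'I_n}) X : exists2 b : nat,
  b%:R <= (n%:R : R) `^ (3 / 4) / 2 + #|Rs|%:R /\ (b <= n)%N &
  (aba pr eps Rs X).2%:R <= kap * n%:R * m0%:R + b%:R * (final_samples pr eps b)%:R.
Proof.
set T := (elim pr eps X n.+1 0 [set: 'I_n]%SET).1.
exists #|T :|: Rs|; first split.
- apply: (@le_trans _ _ (#|T|%:R + #|Rs|%:R)).
    by rewrite -natrD ler_nat leq_card_setU.
  rewrite lerD2r; apply: elim_small.
  by rewrite cardsT card_ord.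
- by rewrite -[leqRHS]card_ord max_card.
- rewrite /aba -/T; set E := elim _ _ _ _ _ _; rewrite [_.2]/= natrD natrM lerD2r.
  apply: le_trans (elim_cost _ _ _ _) _.
  by rewrite cardsT card_ord mul1r.
Qed.

End sample_complexity.

(** Rounding up costs at most 1, which is at most [2 / n^(3/4)] times [#|S|] when the set is not
    small. *)
Lemma kept_bound (R : realType) (n : nat) (pr : params R) (S : {set 'I_n}) :
  (0 < n)%N -> 0 <= dprime pr -> 0 <= phi pr -> ~~ small R S ->
  (kept pr S)%:R <= (dprime pr + phi pr + 2 / (n%:R : R) `^ (3 / 4)) * #|S|%:R.
Proof.
move=> n0 d0 p0; rewrite /small -ltNge => sS.
rewrite [leRHS]mulrDl; apply: le_trans (ltW (ceilN_lt _)) _.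
  by rewrite mulr_ge0// addr_ge0.
rewrite lerD2l; have K0 : 0 < (n%:R : R) `^ (3 / 4) by rewrite powR_gt0// ltr0n.
by rewrite [leRHS]mulrAC ler_pdivlMr//; lra.
Qed.

(** * Averaging over the random set of arms *)

(** A random [r]-subset avoids [g] given points with probability at most [(1 - r / N)^g]: forbidding
    one more point multiplies the count by [(N - g - r) / (N - g)], which is at most
    [(N - r) / N]. *)
Lemma bin_sub_le (N g r : nat) : ('C(N - g, r) * N ^ g <= (N - r) ^ g * 'C(N, r))%N.
Proof.
elim: g => [|g IH]; first by rewrite subn0 !expn0 muln1 mul1n.
case: N IH => [_|N IH]; first by rewrite exp0n ?muln0.
have [gN|Ng] := ltnP g N.+1; last first.
  have -> : (N.+1 - g.+1 = 0)%N by lia.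
  by case: r {IH} => [|r]; rewrite ?subn0 ?bin0 ?mul1n ?muln1.
have h : ((N.+1 - g) * 'C(N.+1 - g.+1, r) = (N.+1 - g - r) * 'C(N.+1 - g, r))%N.
  by rewrite subnS mul_bin_down.
have N0 : (0 < N.+1 - g)%N by lia.
have h' : ((N.+1 - g - r) * N.+1 <= (N.+1 - g) * (N.+1 - r))%N by nia.
rewrite -(leq_pmul2l N0) mulnA h; apply: leq_trans (leq_trans (leq_mul h' IH) _).
  by rewrite expnS; apply: eq_leq; ring.
by rewrite expnS; apply: eq_leq; ring.
Qed.

Lemma bin_sub_exp (R : realType) (N g r : nat) : (0 < N)%N -> (r <= N)%N ->
  'C(N - g, r)%:R <= expR (- (g%:R * r%:R / N%:R)) * 'C(N, r)%:R :> R.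
Proof.
move=> N0 rN.
have N0' : 0 < N%:R :> R by rewrite ltr0n.
have := bin_sub_le N g r; rewrite -(ler_nat R) !natrM !natrX natrB// => h.
have e1 : (N%:R - r%:R) / N%:R <= expR (- (r%:R / N%:R)) :> R.
  apply: le_trans (expR_ge1Dx _); rewrite mulrBl divff ?gt_eqF//.
have e0 : 0 <= (N%:R - r%:R) / N%:R :> R by rewrite divr_ge0// subr_ge0 ler_nat.
have -> : - (g%:R * r%:R / N%:R) = g%:R * (- (r%:R / N%:R)) :> R by ring.
rewrite expRM_natl; apply: (@le_trans _ _ (((N%:R - r%:R) / N%:R) ^+ g * 'C(N, r)%:R)).
  by rewrite exprMn exprVn mulrAC ler_pdivlMr ?exprn_gt0.
by rewrite ler_wpM2r// lerXn2r// nnegrE// expR_ge0.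
Qed.

Section averaging.
Context {R : realType} {n : nat} (pr : params R) (P : arm_instance R n) (eps : R) (M : nat).
Hypothesis rn : (rsize R n <= n)%N.
Let pS (Rs : {set 'I_n}) := Pr P (coords n M) (fun X => success P eps (aba pr eps Rs X).1).

Let C0 : 0 < 'C(n, rsize R n)%:R :> R.
Proof. by rewrite ltr0n bin_gt0. Qed.

Lemma success_prob_ge (w : {set 'I_n} -> R) (s : R) :
  (forall Rs : {set 'I_n}, #|Rs| = rsize R n -> (w Rs)%:E <= pS Rs)%E ->
  s * 'C(n, rsize R n)%:R <= \sum_(Rs : {set 'I_n} | #|Rs| == rsize R n) w Rs ->
  (s%:E <= success_prob pr P eps M)%E.
Proof.
move=> wp sw; rewrite /success_prob.
(* The comprehension in [success_prob] is a classical set, so membership is converted before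
   [card_draws] applies. *)
have -> : #|[set Rs : {set 'I_n} | #|Rs| == rsize R n]| = 'C(n, rsize R n).
  transitivity 'C(#|'I_n|, rsize R n); last by rewrite card_ord.
  rewrite -card_draws; apply: eq_card => Rs; rewrite [RHS]inE.
  by apply/idP/idP => [/set_mem//|h]; exact: mem_set.
apply: (@le_trans _ _ (('C(n, rsize R n)%:R^-1)%:E *
   (\sum_(Rs : {set 'I_n} | #|Rs| == rsize R n) w Rs)%:E)%E).
  by rewrite -EFinM lee_fin mulrC ler_pdivlMr.
apply: lee_wpmul2l; first by rewrite lee_fin invr_ge0 ltW.
by rewrite -sumEFin; apply: lee_sum => Rs /eqP; exact: wp.
Qed.

Lemma success_prob_ge_cst (s : R) :
  (forall Rs : {set 'I_n}, #|Rs| = rsize R n -> s%:E <= pS Rs)%E ->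
  (s%:E <= success_prob pr P eps M)%E.
Proof.
move=> sp; apply: (success_prob_ge (w := fun=> s)) => //.
rewrite sumr_const mulr_natr.
have -> : #|(fun Rs : {set 'I_n} => #|Rs| == rsize R n)| =
          #|[set Rs : {set 'I_n} | #|Rs| == rsize R n]%SET|.
  by apply: eq_card => Rs; rewrite inE.
by rewrite card_draws card_ord.
Qed.

(** Sets that miss [G] are given weight 0. Their proportion is at most [e], and
    [(1 - q) * (1 - e) >= 1 - q - e]. *)
Lemma success_prob_ge_hit (G : {set 'I_n}) (q : R) : 0 <= q <= 1 ->
  (forall (Rs : {set 'I_n}) g, #|Rs| = rsize R n -> g \in Rs -> g \in G ->
    (1 - q)%:E <= pS Rs)%E ->
  ((1 - q - expR (- (#|G|%:R * (rsize R n)%:R / n%:R)))%:E <= success_prob pr P eps M)%E.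
Proof.
move=> /andP[q0 q1] hit; set e := expR _.
pose w (Rs : {set 'I_n}) := if Rs \subset ~: G then 0 else 1 - q.
apply: (success_prob_ge (w := w)) => [Rs Rr|].
  rewrite /w; case: ifPn => [_|]; first exact: Pr_ge0.
  by move=> /subsetPn[g gR]; rewrite inE negbK; exact: hit.
set r := rsize R n.
have -> : \sum_(Rs : {set 'I_n} | #|Rs| == r) w Rs = (1 - q) * ('C(n, r)%:R - 'C(n - #|G|, r)%:R).
  rewrite (eq_bigr (fun Rs : {set 'I_n} => (1 - q) * (1 - (Rs \subset ~: G)%:R))); last first.
    by move=> Rs _; rewrite /w; case: ifP; rewrite ?subrr ?mulr0// subr0 mulr1.
  rewrite -mulr_sumr sumrB; congr (_ * (_ - _)).
    rewrite -[in RHS](card_ord n) -card_draws -sum1_card natr_sum.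
    by apply: eq_bigl => Rs; rewrite inE.
  have -> : (n - #|G| = #|~: G|)%N by rewrite [RHS]cardsCs finset.setCK card_ord.
  rewrite -cards_draws -sum1_card natr_sum big_mkcond [RHS]big_mkcond/=.
  by apply: eq_bigr => Rs _; rewrite inE andbC; case: (_ == _); case: (_ \subset _).
have CG : 'C(n - #|G|, r)%:R <= e * 'C(n, r)%:R.
  have [n0|n0] := posnP n; last exact: bin_sub_exp.
  have G0 : #|G| = 0%N by apply/eqP; rewrite -leqn0 -n0 (leq_trans (max_card _))// card_ord.
  by rewrite /e G0 subn0 mul0r mul0r oppr0 expR0 mul1r.
have q'0 : 0 <= 1 - q by rewrite subr_ge0.
apply: (@le_trans _ _ ((1 - q) * ('C(n, r)%:R - e * 'C(n, r)%:R))).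
  have := mulr_ge0 (mulr_ge0 q0 (expR_ge0 _ : 0 <= e)) (ltW C0); rewrite -/r.
  by set x := 'C(_, _)%:R; nra.
by rewrite ler_wpM2l// lerB.
Qed.

End averaging.

(** * Choice of the parameters *)

Section root16.
Context {R : realType}.

(* The thresholds [n^(3/4)] and [n^(7/8)] are even powers of [root16 n], which is
   also a bound for [ln n] up to a constant factor. *)
Definition root16 (n : nat) : R := n%:R `^ (1 / 16).

Lemma root16_ge0 n : 0 <= root16 n. Proof. exact: powR_ge0. Qed.

Lemma root16X n k : root16 n ^+ k = n%:R `^ (k%:R / 16).
Proof. by rewrite -powR_mulrn ?root16_ge0// -powRrM mulrC mulrA mulr1. Qed.

Lemma root16_16 n : root16 n ^+ 16 = n%:R.
Proof. by rewrite root16X divff// powRr1. Qed.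

Lemma root16_12 n : n%:R `^ (3 / 4) = root16 n ^+ 12.
Proof. by rewrite root16X; congr (_ `^ _); field. Qed.

Lemma root16_14 n : n%:R `^ (7 / 8) = root16 n ^+ 14.
Proof. by rewrite root16X; congr (_ `^ _); field. Qed.

Lemma le_root16 (V : R) n : 0 <= V -> (Defs.ceilN (V ^+ 16) <= n)%N -> V <= root16 n.
Proof.
move=> V0 Vn; rewrite -(@ler_pXn2r _ 16)// ?nnegrE ?root16_ge0// root16_16.
by apply: le_trans (ceilN_ge _) _; rewrite ler_nat.
Qed.

Lemma ln_root16 n : (0 < n)%N -> ln (n%:R : R) <= 16 * root16 n.
Proof.
move=> n0; have r0 : 0 < root16 n by rewrite powR_gt0// ltr0n.
rewrite -(root16_16 n) lnXn// -[leLHS]mulr_natl ler_pM2l//.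
by rewrite ltW// ln_sublinear.
Qed.

Lemma ln_le_sub1 (x : R) : 0 < x -> ln x <= x - 1.
Proof. by move=> x0; rewrite -[X in ln X](addrNK 1) addrC le_ln1Dx// ltrBrDr addNr. Qed.

End root16.

(** * Numerical bound on the total cost *)

Section cost_bound.
Context {R : realType} (tau v L e : R).
Hypotheses (tau0 : 0 < tau) (tau1 : tau <= 1 / 100) (hv : 218 <= tau ^+ 3 * v).
Hypotheses (hL : 1 <= tau * L) (e0 : 0 < e) (e1 : e <= 1).

Let v_gt0 : 0 < v.
Proof.
have : 0 < tau ^+ 3 * v by apply: lt_le_trans hv.
by rewrite pmulr_rgt0// exprn_gt0.
Qed.

Lemma tau_v : 64 <= tau * v.
Proof.
have : tau ^+ 2 <= 1 / 100 by move: tau0 tau1; nra.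
have tv : 0 < tau * v by rewrite mulr_gt0.
move=> /(ler_wpM2r (ltW tv)); move: hv; rewrite exprS.
by rewrite -mulrA mulrCA; set x := tau * v; set y := _ * x; lra.
Qed.

Lemma v_ge : 64 <= v.
Proof. by have := ler_wpM2r (ltW v_gt0) tau1; have := tau_v; have := v_gt0; lra. Qed.

Let W := L / e ^+ 2.

Let L_gt0 : 0 < L.
Proof. by rewrite -(pmulr_rgt0 _ tau0) (lt_le_trans _ hL). Qed.

Let W_ge : L <= W.
Proof. by rewrite /W ler_pdivlMr ?exprn_gt0// ger_pMr// exprn_ile1// ltW. Qed.

(** Everything is compared with [v ^+ 16 * W], where [v ^+ 16] will be the number of arms. The
    elimination contributes at most [2 + 17 * tau] and the final stage, which has only order
    [v ^+ 15], at most [tau]. *)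
Lemma cost_numeric (lam rho m0 b N : R) :
  18 * tau <= lam -> 0 <= rho <= tau ->
  0 <= m0 <= 2 / ((1 - tau) * e) ^+ 2 * ((1 + tau) * L) + 1 ->
  0 <= b <= 2 * v ^+ 14 -> 0 <= N <= 2 / (tau * e) ^+ 2 * (31 + 48 * v + L) + 1 ->
  (1 - 2 * rho)^-1 * v ^+ 16 * m0 + b * N <= (2 + lam) * v ^+ 16 / e ^+ 2 * L.
Proof.
have t0 := tau0; have t1 := tau1; move=> lamt /andP[r0 r1] /andP[m00 hm0] /andP[b0 hb] /andP[N0 hN].
have W0 : 0 < W by apply: lt_le_trans W_ge.
have tW : 1 <= tau * W by apply: le_trans hL _; rewrite ler_pM2l.
have LW : L = W * e ^+ 2 by rewrite /W divfK// expf_neq0// gt_eqF.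
have e2 : e ^+ 2 != 0 by rewrite expf_neq0// gt_eqF.
have -> : (2 + lam) * v ^+ 16 / e ^+ 2 * L = (2 + lam) * (v ^+ 16 * W).
  by rewrite /W; field; rewrite gt_eqF.
have km : (1 - 2 * rho)^-1 <= 1 + 3 * tau.
  rewrite -div1r ler_pdivrMr; last lra.
  have : 0 <= tau * (1 - 6 * tau) by apply: mulr_ge0; lra.
  have : 0 <= (1 + 3 * tau) * (tau - rho) by apply: mulr_ge0; lra.
  by nra.
(* The coefficient is at most [2 + 9 * tau]; the last [tau * W] pays for the rounding term 1. *)
have mm : m0 <= (2 + 10 * tau) * W.
  apply: le_trans hm0 _.
  have -> : 2 / ((1 - tau) * e) ^+ 2 * ((1 + tau) * L) = (2 * (1 + tau) / (1 - tau) ^+ 2) * W.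
    by rewrite /W; field; apply/andP; split; rewrite gt_eqF//; lra.
  have h : 2 * (1 + tau) / (1 - tau) ^+ 2 <= 2 + 9 * tau.
    rewrite ler_pdivrMr ?exprn_gt0; [|lra..].
    have : 0 <= tau * (3 - 16 * tau) by apply: mulr_ge0; lra.
    have : 0 <= tau ^+ 3 by rewrite exprn_ge0// ltW.
    by rewrite !exprS expr0; nra.
  have := ler_wpM2r (ltW W0) h; lra.
have v16 : 0 < v ^+ 16 by rewrite exprn_gt0.
have h1 : (1 - 2 * rho)^-1 * v ^+ 16 * m0 <= (2 + 17 * tau) * (v ^+ 16 * W).
  apply: (@le_trans _ _ ((1 + 3 * tau) * v ^+ 16 * ((2 + 10 * tau) * W))).
    apply: ler_pM => //.
    - by rewrite mulr_ge0 ?invr_ge0 ?(ltW v16)//; lra.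
    - by rewrite ler_pM2r.
  have -> : (1 + 3 * tau) * v ^+ 16 * ((2 + 10 * tau) * W) =
    ((1 + 3 * tau) * (2 + 10 * tau)) * (v ^+ 16 * W) by ring.
  rewrite ler_pM2r; last exact: mulr_gt0.
  have : 0 <= tau * (1 - 30 * tau) by apply: mulr_ge0; lra.
  by nra.
have h2 : b * N <= tau * (v ^+ 16 * W).
  have vg := v_ge.
  (* The sum [65 + 96 * v] is at most [109 * v]; with [b <= 2 * v ^+ 14] this produces the constant
     218 of [hv]. *)
  have NN : N <= 109 * v / tau ^+ 2 * W.
    apply: le_trans hN _.
    have -> : 2 / (tau * e) ^+ 2 * (31 + 48 * v + L) =
      2 / tau ^+ 2 * ((31 + 48 * v + L) / e ^+ 2).
      by field; rewrite (gt_eqF e0) (gt_eqF tau0).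
    have h : (31 + 48 * v + L) / e ^+ 2 <= (32 + 48 * v) * W.
      rewrite ler_pdivrMr ?exprn_gt0// -mulrA -LW.
      have L1 : 1 <= L by move: hL tau1 L_gt0; nra.
      have : 0 <= (31 + 48 * v) * (L - 1) by apply: mulr_ge0; lra.
      by lra.
    have t2 : 0 < tau ^+ 2 by rewrite exprn_gt0.
    have t20 : 0 <= 2 / tau ^+ 2 by rewrite divr_ge0// ltW.
    have := ler_wpM2l t20 h => h'.
    have i1 : 1 <= 1 / tau ^+ 2 * W.
      have : 1 <= 1 / tau ^+ 2 by rewrite ler_pdivlMr// mul1r exprn_ile1//; lra.
      have : 1 <= W by move: tW tau1 W0; nra.
      by nra.
    apply: (le_trans (lerD h' i1)).
    have -> : 2 / tau ^+ 2 * ((32 + 48 * v) * W) + 1 / tau ^+ 2 * W =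
       (65 + 96 * v) / tau ^+ 2 * W by field; rewrite gt_eqF.
    by rewrite ler_pM2r// ler_pM2r ?invr_gt0//; lra.
  apply: (@le_trans _ _ (2 * v ^+ 14 * (109 * v / tau ^+ 2 * W))); first exact: ler_pM.
  have -> : 2 * v ^+ 14 * (109 * v / tau ^+ 2 * W) = 218 / tau ^+ 2 * (v ^+ 15 * W).
    by field; rewrite gt_eqF.
  have -> : tau * (v ^+ 16 * W) = tau * v * (v ^+ 15 * W) by ring.
  rewrite ler_pM2r; last by apply: mulr_gt0 => //; rewrite exprn_gt0.
  rewrite ler_pdivrMr ?exprn_gt0//; apply: le_trans hv _.
  by rewrite le_eqVlt; apply/orP; left; apply/eqP; ring.
have := lerD h1 h2; have : 0 < v ^+ 16 * W by exact: mulr_gt0.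
set y := v ^+ 16 * W => y0 h3; apply: (le_trans h3).
have := ler_wpM2r (ltW y0) lamt; lra.
Qed.

End cost_bound.

Section parameter_choice.
Context {R : realType}.

(* For [d] this small, [log (n / d)] is [(1 + o(1)) log (1 / d)], so that a union
   bound over all arms is affordable and a single elimination round suffices. *)
Definition tiny (k : nat) (d : R) := d <= expR (- root16 k ^+ 4).

(** For tiny [d], the factor [k.+1] pays for a union bound over the arms and brings the kept
    fraction of [k] arms below one arm. The value [1 / 2] merely keeps the parameter in range when
    [d] is not a confidence level. *)
Definition dprime_of (k : nat) (d : R) : R :=
  if 0 < d < 1 then if tiny k d then d / (4 * k.+1%:R) else d / 4 else 1 / 2.

Definition dsecond_of (k : nat) (d : R) : R :=
  if 0 < d < 1 then d / (8 * k.+1%:R ^+ 2) else 1 / 2.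

(** With [v = root16 k] and [K = v ^+ 12], the choice [v ^- 2] balances the two failure exponents:
    [phi ^+ 2 * K] has order [v ^+ 8], and so has [(phi * K) * v ^+ 14 / v ^+ 16]. Both dominate
    [ln (1 / d)], which is below [v ^+ 4] when [d] in (0,1) is not tiny. *)
Definition phi_of (k : nat) (d : R) : R := if tiny k d then 0 else (root16 k ^+ 2)^-1.

Let div_lt1 (d x : R) : 0 < d < 1 -> 1 <= x -> 0 < d / x < 1.
Proof.
move=> /andP[d0 d1] x1; have x0 : 0 < x by apply: lt_le_trans x1.
by rewrite divr_gt0//= ltr_pdivrMr// mul1r (lt_le_trans d1).
Qed.

Lemma dprime_of01 k d : 0 < dprime_of k d < 1.
Proof.
rewrite /dprime_of; case: ifPn => [d01|_]; last lra.
case: ifP => _; apply: div_lt1 => //; last lra.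
by rewrite -natrM (ler_nat _ 1).
Qed.

Lemma dsecond_of01 k d : 0 < dsecond_of k d < 1.
Proof.
rewrite /dsecond_of; case: ifPn => [d01|_]; last lra.
by apply: div_lt1 => //; rewrite -natrX -natrM (ler_nat _ 1).
Qed.

Lemma phi_of_ge0 k d : 0 <= phi_of k d.
Proof. by rewrite /phi_of; case: ifP => // _; rewrite invr_ge0 exprn_ge0// root16_ge0. Qed.

Lemma phi_of_cvg0 d : (fun k => phi_of k d) @ \oo --> (0 : R).
Proof.
apply/cvgrPdist_le => e e0; near=> k.
rewrite sub0r normrN ger0_norm ?phi_of_ge0// /phi_of; case: ifP => _; first exact: ltW.
(* The square of [1 + e^-1] exceeds [e^-1], whether or not [e] is below 1. *)
have V0 : 0 <= 1 + e^-1 by rewrite addr_ge0// invr_ge0 ltW.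
have kV : (Defs.ceilN ((1 + e^-1) ^+ 16) <= k)%N by near: k; exact: nbhs_infty_ge.
have h := le_root16 V0 kV.
have e'0 : 0 < e^-1 by rewrite invr_gt0.
have r0 : 0 < root16 k :> R by apply: lt_le_trans h; rewrite ltr_wpDr// ltW.
rewrite -[leRHS]invrK lef_pV2 ?posrE ?exprn_gt0//.
by rewrite expr2; nra.
Unshelve. all: by end_near. Qed.

End parameter_choice.

(** * Cost and success probability for the chosen parameters *)

Section main.
Context {R : realType} (lam tau : R).
Hypotheses (tau0 : 0 < tau) (tau1 : tau <= 1 / 100) (lamt : 18 * tau <= lam).
Variables (delta : R) (n : nat) (eps : R).
Hypotheses (delta0 : 0 < delta) (delta1 : delta < expR (- (3 / tau))).
Hypothesis hv : 218 <= tau ^+ 3 * root16 n.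
Hypotheses (eps0 : 0 < eps) (eps1 : eps <= 1).
Let pr := Params (1 - tau) (dprime_of n delta) (dsecond_of n delta) (phi_of n delta).
Let v : R := root16 n.
Let L : R := ln (1 / delta).

Let v_ge : 64 <= v. Proof. exact: (v_ge tau0 tau1 hv). Qed.
Let v_gt0 : 0 < v.
Proof. by apply: lt_le_trans v_ge; rewrite ltr0n. Qed.
Let v16 : v ^+ 16 = n%:R. Proof. exact: root16_16. Qed.
Let vX_ge k : 1 <= v ^+ k.
Proof. by apply: exprn_ege1; apply: le_trans v_ge; rewrite (ler_nat _ 1). Qed.
Let n_gt0 : (0 < n)%N.
Proof. by rewrite -(ltr_nat R) -v16 exprn_gt0. Qed.

(** The constant 3 bounds [ln 4], which the choice [dprime = delta / 4] adds to [L]. *)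
Let L_gt : 3 <= tau * L.
Proof.
rewrite /L div1r lnV ?posrE// mulrC -ler_pdivrMr// lerNr.
by rewrite -[leRHS]expRK ler_ln ?posrE ?expR_gt0// ltW.
Qed.

Let delta01 : 0 < delta < 1.
Proof.
rewrite delta0/= (lt_le_trans delta1)// -[leRHS]expR0 ler_expR oppr_le0.
by rewrite divr_ge0// ltW.
Qed.

Let tiny_L : tiny n delta -> v ^+ 4 <= L.
Proof.
rewrite /tiny => h; rewrite /L div1r lnV ?posrE// lerNr.
by rewrite -[leRHS]expRK ler_ln ?posrE ?expR_gt0.
Qed.

Let dprimeE : dprime pr = if tiny n delta then delta / (4 * n.+1%:R) else delta / 4.
Proof. by rewrite /= /dprime_of delta01. Qed.

Let dsecondE : dsecond pr = delta / (8 * n.+1%:R ^+ 2).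
Proof. by rewrite /= /dsecond_of delta01. Qed.

Let ln_n : ln (n%:R : R) <= 16 * v. Proof. exact: ln_root16. Qed.

Let nS : n.+1%:R <= 2 * n%:R :> R.
Proof. by rewrite -natrM ler_nat mul2n -addnn -addn1 leq_add2l. Qed.

Let nR0 : 0 < n%:R :> R. Proof. by rewrite ltr0n. Qed.

Let tv4 : 16 * v + 8 <= tau * v ^+ 4.
Proof.
have h : 64 <= tau * v := tau_v tau0 tau1 hv; have vg := v_ge.
have -> : tau * v ^+ 4 = (tau * v) * v ^+ 3 by ring.
have : v <= v ^+ 3 by rewrite exprS ler_peMr// ltW.
have : 0 <= (tau * v - 64) * v ^+ 3 by rewrite mulr_ge0 ?subr_ge0// exprn_ge0// ltW.
by set x := v ^+ 3; nra.
Qed.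

(** For tiny [delta] the extra term is at most [ln (8 * n) <= 7 + 16 * v], which
    [tau * v ^+ 4 <= tau * L] absorbs. *)
Let ln_dprime : 0 <= ln (1 / dprime pr) <= (1 + tau) * L.
Proof.
have /andP[d0 d1] : 0 < dprime pr < 1 := dprime_of01 _ _.
apply/andP; split; first by rewrite ln_ge0// ler_pdivlMr// mul1r ltW.
have dd0 : 0 < 1 / delta by rewrite divr_gt0.
have hL := L_gt.
rewrite dprimeE; case: ifP => [/tiny_L vL|_].
  have -> : 1 / (delta / (4 * n.+1%:R)) = 4 * n.+1%:R * (1 / delta).
    by rewrite !div1r invf_div.
  apply: (@le_trans _ _ (ln (8 * n%:R * (1 / delta)))).
    have p1 : 0 < 4 * n.+1%:R * (1 / delta) by apply: mulr_gt0 dd0; apply: mulr_gt0; rewrite ltr0n.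
    have p2 : 0 < 8 * n%:R * (1 / delta) by apply: mulr_gt0 dd0; apply: mulr_gt0; rewrite ltr0n.
    rewrite ler_ln ?posrE//; apply: ler_wpM2r; first exact: ltW.
    have := nS; lra.
  have p8 : 0 < 8 * n%:R :> R by apply: mulr_gt0; rewrite // ltr0n.
  rewrite lnM ?posrE// lnM ?posrE// -/L.
  have := ln_le_sub1 (ltr0n R 8); have := ler_wpM2l (ltW tau0) vL.
  by have := tv4; have := ln_n; lra.
have -> : 1 / (delta / 4) = 4 * (1 / delta) by field; rewrite gt_eqF.
rewrite lnM ?posrE// -/L; have := ln_le_sub1 (ltr0n R 4); lra.
Qed.

(** The quotient is at most [32 * n^3 / delta], with [ln 32 <= 31] and [3 * ln n <= 48 * v]. *)
Let ln_dsecond (b : nat) : (b <= n)%N ->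
  0 <= ln (b%:R / dsecond pr) <= 31 + 48 * v + L.
Proof.
move=> bn; have /andP[d0 d1] : 0 < dsecond pr < 1 := dsecond_of01 _ _.
(* For [b = 0] the logarithm takes its default value 0. *)
have [->|b0] := posnP b.
  have hL : 0 <= L by have := L_gt; have t0 := tau0; rewrite -(pmulr_rge0 _ tau0); lra.
  by rewrite mul0r ln0// lexx/=; have := v_gt0; lra.
apply/andP; split.
  by rewrite ln_ge0// ler_pdivlMr// mul1r (le_trans (ltW d1))// (ler_nat _ 1).
have dd0 : 0 < 1 / delta by rewrite divr_gt0.
have n30 : 0 < 32 * n%:R ^+ 3 :> R by rewrite mulr_gt0// exprn_gt0.
apply: (@le_trans _ _ (ln (32 * n%:R ^+ 3 * (1 / delta)))).
  have p1 : 0 < b%:R / dsecond pr by rewrite divr_gt0// ltr0n.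
  have p2 : 0 < 32 * n%:R ^+ 3 * (1 / delta) by exact: mulr_gt0.
  rewrite ler_ln ?posrE//.
  rewrite dsecondE invf_div mulrA mulr1 mulrA ler_pM2r ?invr_gt0//.
  have : b%:R * (8 * n.+1%:R ^+ 2) <= n%:R * (8 * (2 * n%:R) ^+ 2) :> R.
    apply: ler_pM => //; first by rewrite ler_nat.
    by rewrite ler_pM2l// lerXn2r// nnegrE// mulr_ge0.
  move=> h; apply: le_trans h _.
  by rewrite le_eqVlt; apply/orP; left; apply/eqP; ring.
rewrite lnM ?posrE// lnM ?posrE ?exprn_gt0// lnXn// -/L -[ln _ *+ 3]mulr_natl.
by have := ln_n; have := ln_le_sub1 (ltr0n R 32); lra.
Qed.

Let K_eq : (n%:R : R) `^ (3 / 4) = v ^+ 12. Proof. exact: root16_12. Qed.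

Let rho : R := dprime pr + phi pr + 2 / (n%:R : R) `^ (3 / 4).

Let dprime_le : dprime pr <= delta / 4.
Proof.
have N0 : 0 < 4 * n.+1%:R :> R by apply: mulr_gt0; rewrite ltr0n.
rewrite dprimeE; case: ifP => // _; rewrite ler_pM2l// lef_pV2 ?posrE//.
by rewrite ler_peMr// (ler_nat _ 1).
Qed.

Let delta_tau : delta <= tau.
Proof.
apply: (le_trans (ltW delta1)); rewrite expRN -[leRHS]invrK lef_pV2 ?posrE ?expR_gt0 ?invr_gt0//.
apply: le_trans (expR_ge1Dx _).
have : tau^-1 <= 3 / tau by rewrite -[leLHS]mul1r ler_pM2r ?invr_gt0// (ler_nat _ 1).
lra.
Qed.

Let vinv k : (0 < k)%N -> (v ^+ k)^-1 <= tau / 64.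
Proof.
move=> k0; have h : 64 <= tau * v := tau_v tau0 tau1 hv.
apply: (@le_trans _ _ v^-1).
  rewrite lef_pV2 ?posrE ?exprn_gt0//; case: k k0 => // k _.
  by rewrite exprS ler_peMr// ltW.
by rewrite -div1r ler_pdivrMr//; lra.
Qed.

Let rho_bounds : 0 <= rho <= tau.
Proof.
have /andP[d0 d1] : 0 < dprime pr < 1 := dprime_of01 _ _.
have p0 : 0 <= phi pr := phi_of_ge0 _ _.
have p1 : phi pr <= tau / 64.
  rewrite /= /phi_of; case: ifP => _; first by rewrite divr_ge0// ltW.
  exact: vinv.
have k1 := vinv (isT : (0 < 12)%N); have k0 : 0 < (v ^+ 12)^-1 by rewrite invr_gt0 exprn_gt0.
by have := dprime_le; have := delta_tau; rewrite /rho K_eq; have := tau0; lra.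
Qed.

Let rsize_bounds : v ^+ 14 / 2 <= (rsize R n)%:R <= v ^+ 14 / 2 + 1.
Proof.
rewrite /rsize root16_14 ceilN_ge/= ltW// ceilN_lt// divr_ge0// exprn_ge0// ltW//.
Qed.

Let rsize_le : (rsize R n <= n)%N.
Proof.
rewrite /rsize root16_14; apply: ceilN_le.
  by rewrite divr_ge0// exprn_ge0// ltW//.
rewrite -v16 -/v; have -> : v ^+ 16 = v ^+ 14 * v ^+ 2 by rewrite -exprD.
by rewrite ler_pM2l ?exprn_gt0// (le_trans _ (vX_ge 2))// invf_le1// (ler_nat _ 1).
Qed.

Lemma cost_le (Rs : {set 'I_n}) (X : table R n) : #|Rs| = rsize R n ->
  (aba pr eps Rs X).2%:R <= (2 + lam) * n%:R / eps ^+ 2 * ln (1 / delta).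
Proof.
move=> Rr; have /andP[r0 r1] := rho_bounds; have t1 := tau1; have t0 := tau0.
have rho14 : 0 <= rho <= 1 / 4 by apply/andP; split => //; lra.
have p0 : 0 <= phi pr := phi_of_ge0 _ _.
have /andP[d0 d1] : 0 < dprime pr < 1 := dprime_of01 _ _.
have kl (S : {set 'I_n}) : ~~ small R S -> (kept pr S)%:R <= rho * #|S|%:R.
  by apply: kept_bound => //; exact: ltW.
have [b [bK bn] h] := aba_cost eps rho14 kl Rs X.
apply: (le_trans h); rewrite -v16 -/L.
have hL : 1 <= tau * L by have := L_gt; lra.
apply: (@cost_numeric _ tau v L eps tau0 tau1 hv hL eps0 eps1 lam rho) => //.
- have /andP[l0 l1] := ln_dprime.
  rewrite ler0n /=; rewrite /round_samples mul1n; apply: (le_trans (ltW (ceilN_lt _))).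
    by rewrite mulr_ge0// divr_ge0// sqr_ge0.
  by rewrite lerD2r ler_wpM2l// divr_ge0// sqr_ge0.
- rewrite ler0n /=; apply: (le_trans bK); rewrite Rr K_eq.
  have /andP[_ r2] := rsize_bounds.
  have := vX_ge 14; have : v ^+ 12 <= v ^+ 14.
    by rewrite -[14%N]/(12 + 2)%N exprD ler_peMr// exprn_ge0// ltW.
  by lra.
- have /andP[l0 l1] := ln_dsecond bn.
  rewrite ler0n /= /final_samples; apply: (le_trans (ltW (ceilN_lt _))).
    by rewrite mulr_ge0// divr_ge0// sqr_ge0.
  rewrite [alpha _]/= (_ : 1 - (1 - tau) = tau); last by ring.
  by rewrite lerD2r ler_wpM2l// divr_ge0// sqr_ge0.
Qed.

Lemma mem_coords (c : 'I_n * nat * nat) M : (c.1.2 < M)%N -> (c.2 < M)%N -> c \in coords n M.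
Proof.
case: c => [[a p] j] /= pM jM; apply/flattenP.
exists [seq (ap, j) | ap <- [seq (a, p) | a <- enum 'I_n, p <- iota 0 M]].
  by apply/mapP; exists j; rewrite ?mem_iota.
apply/mapP; exists (a, p) => //; apply/allpairsP; exists (a, p).
by rewrite mem_enum mem_iota.
Qed.

(** From this size on, [coords n M] contains all phases up to [n.+2] and, in each of them, every
    draw that can be used; the sums bound each single sample count. *)
Let M0 : nat := (n.+3 + \sum_(i < n.+1) round_samples pr eps i +
   \sum_(k < n.+1) final_samples pr eps k)%N.

Lemma success_le (P : arm_instance R n) M : supported01 P -> (M0 <= M)%N ->
  ((1 - delta)%:E <= success_prob pr P eps M)%E.
Proof.
move=> P01 MM; have t0 := tau0; have t1 := tau1; have d0 := delta0.
have alp01 : 0 < alpha pr < 1 by rewrite /=; lra.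
have dp01 : 0 < dprime pr < 1 := dprime_of01 _ _.
have dpp01 : 0 < dsecond pr < 1 := dsecond_of01 _ _.
have p0 : 0 <= phi pr := phi_of_ge0 _ _.
have [astar amax] : exists astar, forall b, arm_mean P b <= arm_mean P astar.
  exists [arg max_(a > Ordinal n_gt0) arm_mean P a]%O.
  by case: arg_maxP => // a _ amax b; exact: amax.
have M3 : (n.+3 <= M)%N by apply: leq_trans MM; rewrite /M0 -addnA leq_addr.
have rL a i j : (i < n.+1)%N -> (j < round_samples pr eps i)%N -> (a, i, j) \in coords n M.
  move=> ni ji; apply: mem_coords => /=; first exact: leq_trans (leqW (leqW ni)) M3.
  apply: leq_trans (leq_trans ji _) MM; rewrite /M0 (bigD1 (Ordinal ni))//=.
  exact: leq_trans (leq_addr _ _) (leq_trans (leq_addl _ _) (leq_addr _ _)).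
have fL a k j : (k <= n)%N -> (j < final_samples pr eps k)%N -> (a, n.+2, j) \in coords n M.
  rewrite -ltnS => nk jk; apply: mem_coords => //=.
  apply: leq_trans (leq_trans jk _) MM.
  rewrite /M0 [X in (_ + X)%N](bigD1 (Ordinal nk))//=.
  exact: leq_trans (leq_addr _ _) (leq_addl _ _).
have q2 : (n * n)%:R * (2 * dsecond pr) <= delta / 4.
  rewrite dsecondE natrM; set N := n.+1%:R.
  have N0 : 0 < N :> R by rewrite ltr0n.
  have -> : 2 * (delta / (8 * N ^+ 2)) = delta / 4 / N ^+ 2 by field; rewrite gt_eqF.
  rewrite mulrA ler_pdivrMr ?exprn_gt0// [leLHS]mulrC ler_pM2l ?divr_gt0// expr2.
  by rewrite ler_pM// ler_nat.
have v14 : 1 <= v ^+ 12 / 2.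
  rewrite ler_pdivlMr// mul1r; have := ler_wpM2l (ltW v_gt0) (vX_ge 11).
  by rewrite mulr1 -exprS; have := v_ge; lra.
have [tn|tnN] := boolP (tiny n delta).
  have dE : dprime pr = delta / (4 * n.+1%:R) by rewrite dprimeE tn.
  have q1 : n%:R * (2 * dprime pr) <= delta / 2.
    rewrite dE; set N := n.+1%:R; have N0 : 0 < N :> R by rewrite ltr0n.
    have -> : 2 * (delta / (4 * N)) = delta / 2 / N by field; rewrite gt_eqF.
    by rewrite mulrA ler_pdivrMr// [leLHS]mulrC ler_pM2l ?divr_gt0// ler_nat.
  (* Here [phi] vanishes, and [dprime * n] is positive and at most 1, so it rounds up to 1. *)
  have kE : kept pr [set: 'I_n]%SET = 1%N.
    have phE : phi pr = 0 by rewrite /= /phi_of tn.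
    rewrite /kept cardsT card_ord dE phE addr0.
    have x0 : 0 < delta / (4 * n.+1%:R) * n%:R :> R.
      by rewrite mulr_gt0// divr_gt0// mulr_gt0// ltr0n.
    apply/eqP; rewrite eqn_leq ceilN_gt0// andbT; apply: ceilN_le; first exact: ltW.
    rewrite mulrAC ler_pdivrMr ?mulr_gt0 ?ltr0n// mul1r.
    apply: ler_pM => //; first exact: ltW.
      by case/andP: delta01 => _ /ltW h; apply: le_trans h _; rewrite (ler_nat _ 1).
    by rewrite ler_nat.
  have nsm : ~~ small R [set: 'I_n]%SET.
    rewrite /small cardsT card_ord K_eq -ltNge -v16.
    have -> : v ^+ 16 = v ^+ 12 * v ^+ 4 by rewrite -exprD.
    rewrite ltr_pM2l ?exprn_gt0// (lt_le_trans _ (vX_ge 4))//.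
    by rewrite invf_lt1// (ltr_nat _ 1).
  apply: (success_prob_ge_cst rsize_le) => Rs Rr.
  apply: le_trans (success_one_round P01 eps0 alp01 dp01 dpp01 amax rL fL Rs kE nsm _).
    rewrite lee_fin lerD2l lerN2; apply: (le_trans (lerD q1 q2)); lra.
  by rewrite K_eq.
have dE : dprime pr = delta / 4 by rewrite dprimeE (negbTE tnN).
have phE : phi pr = (v ^+ 2)^-1 by rewrite /= /phi_of (negbTE tnN).
have dt : expR (- v ^+ 4) <= delta by rewrite ltW// ltNge.
have vg := v_ge.
(* The exponent [v ^+ 8 / 8] leaves room for [ln (1 / delta) < v ^+ 4], for a factor 4, and for
   [ln (2 * n)]. *)
have v8 : v ^+ 4 + 16 * v + 20 <= v ^+ 8 / 8.
  have : v ^+ 8 = v ^+ 4 * v ^+ 4 by rewrite -exprD.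
  have : 64 * v <= v ^+ 4.
    have -> : v ^+ 4 = v ^+ 3 * v by rewrite -exprSr.
    rewrite ler_pM2r//; apply: (le_trans vg).
    by rewrite exprS ler_peMr// ltW.
  by set x := v ^+ 4 => vx ->; nra.
have e8 : expR (- (v ^+ 8 / 8)) <= delta / 4.
  apply: (@le_trans _ _ (expR (- v ^+ 4) / 4)); last by rewrite ler_pM2r.
  rewrite ler_pdivlMr//; apply: (@le_trans _ _ (expR (- (v ^+ 8 / 8)) * expR 4)).
    rewrite ler_pM2l ?expR_gt0//; apply: le_trans (expR_ge1Dx _); lra.
  by rewrite -expRD ler_expR; lra.
have [few|many] := leP (#|[set a | good P pr eps astar a]%SET|%:R) (phi pr * v ^+ 12 / 4).
  apply: (success_prob_ge_cst rsize_le) => Rs Rr.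
  have d2 : dprime pr <= 1 / 2 by rewrite dE; case/andP: delta01; lra.
  apply: le_trans (success_few_good P01 eps0 alp01 dp01 dpp01 p0 amax rL fL Rs d2 _); last first.
    by rewrite K_eq.
  rewrite lee_fin K_eq phE.
  have -> : (v ^+ 2)^-1 ^+ 2 * v ^+ 12 / 4 = v ^+ 8 / 4 by field; rewrite gt_eqF.
  (* Of the budget [delta], the best arm's own deviations take [2 * dprime = delta / 2] and the
     final stage [delta / 4]. *)
  suff : n.+1%:R * expR (- (v ^+ 8 / 4)) <= delta / 4 by rewrite dE; lra.
  apply: le_trans e8.
  (* One half of the exponent pays for the factor [n.+1], the other half gives [delta / 4]. *)
  have -> : - (v ^+ 8 / 4) = - (v ^+ 8 / 8) - v ^+ 8 / 8 by field.
  rewrite expRD mulrCA ger_pMr ?expR_gt0// expRN ler_pdivrMr ?expR_gt0// mul1r.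
  apply: (le_trans nS); rewrite -[2 * _]lnK ?posrE ?mulr_gt0// ler_expR lnM ?posrE//.
  have := ln_n; have := ln_le_sub1 (ltr0n R 2); have := vX_ge 4; lra.
set G := [set a | good P pr eps astar a]%SET in many.
have q01 : 0 <= (n * n)%:R * (2 * dsecond pr) <= 1.
  case/andP: dpp01 => dd0 _; rewrite mulr_ge0 ?mulr_ge0// ?(ltW dd0)//=.
  by apply: (le_trans q2); case/andP: delta01; lra.
apply: le_trans (success_prob_ge_hit (G := G) rsize_le q01 _); last first.
  move=> Rs g Rr gR; rewrite inE => gg.
  exact: (success_hit P01 eps0 alp01 dpp01 amax fL gR gg).
rewrite lee_fin.
suff : expR (- (#|G|%:R * (rsize R n)%:R / n%:R)) <= delta / 4 by lra.
apply: le_trans e8; rewrite ler_expR lerN2 -v16 ler_pdivlMr ?exprn_gt0//.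
have /andP[r1 _] := rsize_bounds.
(* More than [v ^+ 10 / 4] good arms and at least [v ^+ 14 / 2] random ones: their product divided
   by [n = v ^+ 16] is at least [v ^+ 8 / 8]. *)
apply: (@le_trans _ _ ((phi pr * v ^+ 12 / 4) * (v ^+ 14 / 2))).
  by rewrite phE le_eqVlt; apply/orP; left; apply/eqP; field; rewrite gt_eqF.
apply: ler_pM => //; last exact: ltW.
  by rewrite divr_ge0// mulr_ge0// exprn_ge0// ltW.
by rewrite divr_ge0// exprn_ge0// ltW.
Qed.

End main.

Unset Implicit Arguments.

Theorem theorem2 (R : realType) (lam : R) : 0 < lam ->
  exists (delta0 : R) (n0 : nat)
         (alp dp dpp ph : nat -> R -> R),
    0 < delta0 /\
    (forall (k : nat) (d : R), 0 < alp k d < 1 /\ 0 < dp k d < 1 /\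
                               0 < dpp k d < 1 /\ 0 <= ph k d) /\
    (forall d : R, (fun k => ph k d) @ \oo --> (0 : R)) /\
    forall (delta : R), 0 < delta -> delta < delta0 ->
    forall (n : nat), (n0 <= n)%N ->
    forall (eps : R), 0 < eps <= 1 ->
    let pr := Params (alp n delta) (dp n delta) (dpp n delta) (ph n delta) in
    forall P : arm_instance R n, supported01 P ->
      (\forall M \near \oo, (1 - delta)%:E <= success_prob pr P eps M)%E /\
      (forall (Rs : {set 'I_n}) (X : table R n), #|Rs| = rsize R n ->
         ((aba pr eps Rs X).2)%:R
           <= (2 + lam) * n%:R / eps ^+ 2 * ln (1 / delta)).
Proof.
(* The slack [tau] is both [1 - alpha] and the unit of relative error. The total error is
   [18 * tau], and [tau <= 1 / 100] serves the numerical estimates. *)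
move=> lam0; pose tau := Num.min lam 1 / 100.
have tau0 : 0 < tau by rewrite divr_gt0// lt_min lam0 ltr01.
have tau1 : tau <= 1 / 100 by rewrite ler_pM2r// ge_min lexx orbT.
have lamt : 18 * tau <= lam.
  have : Num.min lam 1 <= lam by rewrite ge_min lexx.
  have : 0 < Num.min lam 1 by rewrite lt_min lam0 ltr01.
  by rewrite /tau; lra.
(* The first threshold amounts to [tau * ln (1 / delta) > 3], the second forces
   [tau ^+ 3 * root16 n >= 218]. *)
exists (expR (- (3 / tau))), (Defs.ceilN ((218 / tau ^+ 3) ^+ 16)).
exists (fun _ _ => 1 - tau), dprime_of, dsecond_of, phi_of.
split; first exact: expR_gt0.
split.
  move=> k d; split; first lra.
  by split; [exact: dprime_of01|split; [exact: dsecond_of01|exact: phi_of_ge0]].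
split; first exact: phi_of_cvg0.
move=> delta d0 d1 n n0 eps /andP[e0 e1] pr P P01.
have nn : 218 <= tau ^+ 3 * root16 n.
  have t3 : 0 < tau ^+ 3 by rewrite exprn_gt0.
  rewrite mulrC -(ler_pdivrMr _ _ t3); apply: le_root16 n0.
  by apply: divr_ge0; [rewrite ler0n|exact: ltW].
split.
  near=> M; apply: (success_le tau0 tau1 d0 d1 nn e0 P01).
  by near: M; exact: nbhs_infty_ge.
by move=> Rs X Rr; exact: (cost_le tau0 tau1 lamt d0 d1 nn e0 e1 X Rr).
Unshelve. all: by end_near. Qed.
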